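(* Let $A,B,C\in\mathbb{Z}$ and $F(x,y)=Ax^4+Bx^2y^2+Cy^4$. (a) For an odd prime $p$, $Q_F$ is maximal at $p$ if and only if $p$ does not divide all of $A,B,C$, and $A,C,B^2-4AC\not\equiv 0\pmod{p^2}$. (b) $Q_F$ is maximal at $2$ if and only if $A,B,C$ are not all even, $A,C\not\equiv0\pmod 4$, and: $A+B+C\not\equiv 0\pmod 4$ when one of $A,B,C$ is even; $A+B\equiv0\pmod4$ or $B+C\equiv0\pmod 4$ when $A,B,C$ are all odd.
   Context: For an integral binary quartic form $F=a_4x^4+a_3x^3y+a_2x^2y^2+a_1xy^3+a_0y^4$, $Q_F$ is the quartic ring associated to $F$ by Birch–Merriman/Nakagawa (equivalently, by Wood, the quartic ring corresponding under Bhargava's parametrization to the pair of ternary quadratic forms $(U_0,V_F)$ with $U_0=-xy+z^2$, $V_F=a_0x^2+a_4y^2+a_2z^2+a_1xz+a_3yz$); as a $\mathbb{Z}$-module it has basis $1,\zeta_1,\zeta_2,\zeta_3$ and, when $F$ is irreducible and $\theta$ is a root of $F(x,1)$, $\zeta_1=a_4\theta$, $\zeta_2=a_4\theta^2+a_3\theta$, $\zeta_3=a_4\theta^3+a_3\theta^2+a_2\theta$. $Q_F$ is maximal at a prime $p$ if $\mathbb{Z}_p\otimes_{\mathbb{Z}}Q_F$ is a maximal quartic ring over $\mathbb{Z}_p$. *)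

(* Defs.v *)
From HB Require Import structures.
From mathcomp Require Import all_boot all_order all_algebra.
From mathcomp Require Import boolp ring.
Set Implicit Arguments.
Unset Strict Implicit.
Unset Printing Implicit Defensive.
Import GRing.Theory.
Local Open Scope ring_scope.

(* The p-adic integers, as the inverse limit of the rings Z/p^(n+1)Z, n >= 0.
   Since 'Z_m is Z/mZ only for m > 1, this is Z_p only for p > 1. *)

Definition padic_red (p n : nat) (x : 'Z_(p ^ n.+2)) : 'Z_(p ^ n.+1) :=
  (x : nat)%:R.

Record padic_int (p : nat) := PadicInt {
  padic_res :> forall n, 'Z_(p ^ n.+1);
  padic_resP : forall n, padic_red (padic_res n.+1) = padic_res n
}.

Section PadicInt.
Variable p : nat.
Implicit Types x y z : padic_int p.

Lemma padic_eqP x y : (forall n, x n = y n) -> x = y.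
Proof.
case: x y => [f hf] [g hg] /= fg.
have e : f = g by apply: functional_extensionality_dep.
by case: _ / e hg => hg; congr PadicInt; apply: Prop_irrelevance.
Qed.

Lemma padic_red_nat n (k : nat) :
  padic_red (k%:R : 'Z_(p ^ n.+2)) = k%:R.
Proof.
rewrite /padic_red; apply: val_inj; rewrite !Zp_nat /=.
case: (ltnP 1 p) => [p_gt1|].
  rewrite !Zp_cast ?ltn_exp2l ?(ltn_exp2l 0) //.
  by rewrite modn_dvdm // dvdn_exp2l.
by case: p => [|[|q]] // _; rewrite ?exp0n ?exp1n ?modn_mod.
Qed.

Let natZ m (x : 'Z_m) : exists k : nat, x = k%:R.
Proof. by exists x; rewrite natr_Zp. Qed.

Lemma padic_redD n : {morph @padic_red p n : x y / x + y}.
Proof.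
move=> x y; have [[k ->] [l ->]] := (natZ x, natZ y).
by rewrite -natrD !padic_red_nat natrD.
Qed.

Lemma padic_redM n : {morph @padic_red p n : x y / x * y}.
Proof.
move=> x y; have [[k ->] [l ->]] := (natZ x, natZ y).
by rewrite -natrM !padic_red_nat natrM.
Qed.

Lemma padic_red0 n : @padic_red p n 0 = 0.
Proof. exact: (padic_red_nat n 0). Qed.

Lemma padic_red1 n : @padic_red p n 1 = 1.
Proof. exact: (padic_red_nat n 1). Qed.

Lemma padic_redN n : {morph @padic_red p n : x / - x}.
Proof.
by move=> x; apply/(addIr (padic_red x)); rewrite -padic_redD !addNr padic_red0.
Qed.

Definition padic_zero : padic_int p :=
  @PadicInt p (fun=> 0) (@padic_red0).
Definition padic_one : padic_int p :=
  @PadicInt p (fun=> 1) (@padic_red1).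

Fact padic_opp_subproof x n : padic_red (- x n.+1) = - x n.
Proof. by rewrite padic_redN padic_resP. Qed.
Definition padic_opp x := PadicInt (padic_opp_subproof x).

Fact padic_add_subproof x y n : padic_red (x n.+1 + y n.+1) = x n + y n.
Proof. by rewrite padic_redD !padic_resP. Qed.
Definition padic_add x y := PadicInt (padic_add_subproof x y).

Fact padic_mul_subproof x y n : padic_red (x n.+1 * y n.+1) = x n * y n.
Proof. by rewrite padic_redM !padic_resP. Qed.
Definition padic_mul x y := PadicInt (padic_mul_subproof x y).

HB.instance Definition _ := gen_eqMixin (padic_int p).
HB.instance Definition _ := gen_choiceMixin (padic_int p).

Fact padic_addA : associative padic_add.
Proof. by move=> x y z; apply: padic_eqP => n; apply: addrA. Qed.
Fact padic_addC : commutative padic_add.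
Proof. by move=> x y; apply: padic_eqP => n; apply: addrC. Qed.
Fact padic_add0 : left_id padic_zero padic_add.
Proof. by move=> x; apply: padic_eqP => n; apply: add0r. Qed.
Fact padic_addN : left_inverse padic_zero padic_opp padic_add.
Proof. by move=> x; apply: padic_eqP => n; apply: addNr. Qed.

HB.instance Definition _ := GRing.isZmodule.Build (padic_int p)
  padic_addA padic_addC padic_add0 padic_addN.

Fact padic_mulA : associative padic_mul.
Proof. by move=> x y z; apply: padic_eqP => n; apply: mulrA. Qed.
Fact padic_mulC : commutative padic_mul.
Proof. by move=> x y; apply: padic_eqP => n; apply: mulrC. Qed.
Fact padic_mul1 : left_id padic_one padic_mul.
Proof. by move=> x; apply: padic_eqP => n; apply: mul1r. Qed.
Fact padic_mulD : left_distributive padic_mul padic_add.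
Proof. by move=> x y z; apply: padic_eqP => n; apply: mulrDl. Qed.
Fact padic_one_neq0 : padic_one != padic_zero.
Proof.
by apply/eqP => /(congr1 (fun x => padic_res x 0%N)) /eqP; rewrite oner_eq0.
Qed.

HB.instance Definition _ := GRing.Zmodule_isComNzRing.Build (padic_int p)
  padic_mulA padic_mulC padic_mul1 padic_mulD padic_one_neq0.

End PadicInt.

(* The form a4 x^4 + a3 x^3 y + a2 x^2 y^2 + a1 x y^3 + a0 y^4. *)
Record binary_quartic (R : Type) := BinaryQuartic {
  bq4 : R; bq3 : R; bq2 : R; bq1 : R; bq0 : R
}.

Definition map_bq (R S : Type) (f : R -> S) (F : binary_quartic R) :=
  BinaryQuartic (f (bq4 F)) (f (bq3 F)) (f (bq2 F)) (f (bq1 F)) (f (bq0 F)).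

Definition bq_eval (R : comNzRingType) (F : binary_quartic R) (x y : R) : R :=
  bq4 F * x ^+ 4 + bq3 F * x ^+ 3 * y + bq2 F * x ^+ 2 * y ^+ 2
  + bq1 F * x * y ^+ 3 + bq0 F * y ^+ 4.

(* Q_F, for a form F over an arbitrary base ring: (c0, c1, c2, c3) stands for
   c0 + c1 zeta_1 + c2 zeta_2 + c3 zeta_3.  The products zeta_i zeta_j are those
   forced by zeta_1 = a4 t, zeta_2 = a4 t^2 + a3 t,
   zeta_3 = a4 t^3 + a3 t^2 + a2 t and F(t, 1) = 0 (see qring_evalM below);
   the resulting table is used for every F, reducible or degenerate ones
   included. *)
Definition qring (R : comNzRingType) (F : binary_quartic R) : Type := 'rV[R]_4.

Section QuarticRing.
Variables (R : comNzRingType) (F : binary_quartic R).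

HB.instance Definition _ := GRing.Lmodule.copy (qring F) 'rV[R]_4.

Definition qcoef (c0 c1 c2 c3 : R) : qring F :=
  \row_(i < 4) [:: c0; c1; c2; c3]`_i.

Definition qbasis (i : nat) : qring F := \row_(k < 4) (k == i :> nat)%:R.

Definition qtable (i j : nat) : qring F :=
  let: BinaryQuartic a4 a3 a2 a1 a0 := F in
  match i, j with
  | 0, _ => qbasis j
  | _, 0 => qbasis i
  | 1, 1 => qcoef 0 (- a3) a4 0
  | 1, 2 | 2, 1 => qcoef 0 (- a2) 0 a4
  | 1, 3 | 3, 1 => qcoef (- (a4 * a0)) (- a1) 0 0
  | 2, 2 => qcoef (- (a4 * a0)) (- a1) (- a2) a3
  | 2, 3 | 3, 2 => qcoef (- (a3 * a0)) (- a0) (- a1) 0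
  | _, _ => qcoef (- (a2 * a0)) 0 (- a0) (- a1)
  end%N.

Definition qmul (x y : qring F) : qring F :=
  \sum_(i < 4) \sum_(j < 4) (x 0 i * y 0 j) *: qtable i j.

Let ord4 (P : 'I_4 -> Prop) : P 0 -> P 1 -> P 2%:R -> P 3%:R -> forall i, P i.
Proof.
move=> P0 P1 P2 P3 [[|[|[|[|]]]] hi] //.
- by rewrite (_ : Ordinal hi = 0) //; apply: val_inj.
- by rewrite (_ : Ordinal hi = 1) //; apply: val_inj.
- by rewrite (_ : Ordinal hi = 2%:R) //; apply: val_inj.
- by rewrite (_ : Ordinal hi = 3%:R) //; apply: val_inj.
Qed.

Let sum4 (V : nmodType) (f : 'I_4 -> V) :
  \sum_i f i = f 0 + f 1 + f 2%:R + f 3%:R.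
Proof.
rewrite !big_ord_recl big_ord0 addr0 !addrA.
by congr (f _ + f _ + f _ + f _); apply: val_inj.
Qed.

Lemma qring_coordP (x y : qring F) :
    x 0 0 = y 0 0 -> x 0 1 = y 0 1 -> x 0 2%:R = y 0 2%:R ->
    x 0 3%:R = y 0 3%:R ->
  x = y.
Proof. by move=> e0 e1 e2 e3; apply/rowP; apply: ord4. Qed.

Lemma qbasisE (x : qring F) : x = \sum_(i < 4) x 0 i *: qbasis i.
Proof.
by rewrite sum4; apply/rowP; apply: ord4; rewrite !mxE /=; ring.
Qed.

Lemma qmul_coords (x y : qring F) :
  qmul x y = qcoef
    (x 0 0 * y 0 0
     - bq4 F * bq0 F * (x 0 1 * y 0 3%:R + x 0 3%:R * y 0 1
                        + x 0 2%:R * y 0 2%:R)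
     - bq3 F * bq0 F * (x 0 2%:R * y 0 3%:R + x 0 3%:R * y 0 2%:R)
     - bq2 F * bq0 F * (x 0 3%:R * y 0 3%:R))
    (x 0 0 * y 0 1 + x 0 1 * y 0 0
     - bq3 F * (x 0 1 * y 0 1)
     - bq2 F * (x 0 1 * y 0 2%:R + x 0 2%:R * y 0 1)
     - bq1 F * (x 0 1 * y 0 3%:R + x 0 3%:R * y 0 1 + x 0 2%:R * y 0 2%:R)
     - bq0 F * (x 0 2%:R * y 0 3%:R + x 0 3%:R * y 0 2%:R))
    (x 0 0 * y 0 2%:R + x 0 2%:R * y 0 0
     + bq4 F * (x 0 1 * y 0 1)
     - bq2 F * (x 0 2%:R * y 0 2%:R)
     - bq1 F * (x 0 2%:R * y 0 3%:R + x 0 3%:R * y 0 2%:R)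
     - bq0 F * (x 0 3%:R * y 0 3%:R))
    (x 0 0 * y 0 3%:R + x 0 3%:R * y 0 0
     + bq4 F * (x 0 1 * y 0 2%:R + x 0 2%:R * y 0 1)
     + bq3 F * (x 0 2%:R * y 0 2%:R)
     - bq1 F * (x 0 3%:R * y 0 3%:R)).
Proof.
rewrite /qmul /qtable; case: F => a4 a3 a2 a1 a0 in x y *.
rewrite !sum4 /=.
by apply/rowP; apply: ord4; rewrite !mxE /=; ring.
Qed.

Definition qone : qring F := qbasis 0.

Fact qmulC : commutative qmul.
Proof.
move=> x y; rewrite !qmul_coords.
by apply/rowP; apply: ord4; rewrite !mxE /=; ring.
Qed.

Fact qmulA : associative qmul.
Proof.
move=> x y z; rewrite !qmul_coords.
by apply/rowP; apply: ord4; rewrite !mxE /=; ring.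
Qed.

Fact qmul1 : left_id qone qmul.
Proof.
move=> x; rewrite qmul_coords.
by apply/rowP; apply: ord4; rewrite !mxE /=; ring.
Qed.

Fact qmulD : left_distributive qmul +%R.
Proof.
move=> x y z; rewrite !qmul_coords.
by apply/rowP; apply: ord4; rewrite !mxE /=; ring.
Qed.

Fact qone_neq0 : qone != 0.
Proof.
by apply/eqP => /rowP/(_ 0)/eqP; rewrite !mxE /= oner_eq0.
Qed.

HB.instance Definition _ := GRing.Zmodule_isComNzRing.Build (qring F)
  qmulA qmulC qmul1 qmulD qone_neq0.

Fact qscaleAl (a : R) (x y : qring F) : a *: (x * y) = (a *: x) * y.
Proof.
rewrite -[_ * _]/(qmul _ _) -[RHS]/(qmul _ _) !qmul_coords.
by apply/rowP; apply: ord4; rewrite !mxE /=; ring.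
Qed.

HB.instance Definition _ :=
  GRing.Lmodule_isLalgebra.Build R (qring F) qscaleAl.
HB.instance Definition _ := GRing.Lalgebra_isComAlgebra.Build R (qring F).

Lemma qmulE (x y : qring F) :
  x * y = \sum_(i < 4) \sum_(j < 4) (x 0 i * y 0 j) *: qtable i j.
Proof. by []. Qed.

Lemma qmul_basis (i j : 'I_4) : qbasis i * qbasis j = qtable i j.
Proof.
rewrite qmulE (bigD1 i) //= (bigD1 j) //= !mxE !eqxx mulr1 scale1r.
rewrite big1 => [|k kj]; last first.
  by rewrite !mxE -val_eqE in kj *; rewrite (negPf kj) mulr0 scale0r.
rewrite addr0 big1 ?addr0 // => k ki; rewrite big1 // => l _.
by rewrite !mxE -val_eqE in ki *; rewrite (negPf ki) mul0r scale0r.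
Qed.

(* For a root t of F(x, 1) in an R-algebra, zeta_i |-> its value at t is a
   ring morphism on Q_F. *)
Definition qring_eval (A : comAlgType R) (t : A) (x : qring F) : A :=
  x 0 0 *: 1 + x 0 1 *: (bq4 F *: t)
  + x 0 2%:R *: (bq4 F *: t ^+ 2 + bq3 F *: t)
  + x 0 3%:R *: (bq4 F *: t ^+ 3 + bq3 F *: t ^+ 2 + bq2 F *: t).

Lemma qring_evalM (A : comAlgType R) (t : A) (x y : qring F) :
  bq_eval (map_bq (in_alg A) F) t 1 = 0 ->
  qring_eval t (x * y) = qring_eval t x * qring_eval t y.
Proof.
rewrite /bq_eval !expr1n !mulr1 [map_bq _ _]/= => /eqP.
rewrite addrC addr_eq0 => /eqP Ft.
rewrite -[x * y]/(qmul x y) qmul_coords /qring_eval !mxE /=.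
have E (a : R) (u : A) : a *: u = in_alg A a * u by rewrite mulr_algl.
by move: Ft; rewrite !E !(rmorphD, rmorphN, rmorphM) /= => ->; ring.
Qed.

End QuarticRing.

(* T, with i : Q -> T, is the tensor product of S and Q over the integers, i.e.
   their coproduct in the category of commutative rings. *)
Definition is_tensorZ (S Q : comNzRingType) (T : comAlgType S)
    (i : {rmorphism Q -> T}) : Prop :=
  forall (A : comAlgType S) (g : {rmorphism Q -> A}),
    (exists h : {lrmorphism T -> A}, forall x, h (i x) = g x) /\
    (forall h1 h2 : {lrmorphism T -> A},
      (forall x, h1 (i x) = h2 (i x)) -> forall z, h1 z = h2 z).

Section BaseChange.
Variables (S : comNzRingType) (F : binary_quartic int).
Let FS : binary_quartic S := map_bq intr F.

Definition qring_map (x : qring F) : qring FS := map_mx intr x.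

Fact qring_map_additive : additive qring_map.
Proof. by move=> x y; apply/matrixP => i j; rewrite !mxE rmorphB. Qed.

Let qring_map_basis i : qring_map (qbasis F i) = qbasis FS i.
Proof. by apply/rowP => k; rewrite !mxE; case: (_ == _). Qed.

Fact qring_map_multiplicative : monoid_morphism qring_map.
Proof.
split=> [|x y]; first exact: qring_map_basis.
rewrite -[x * y]/(qmul x y) -[RHS]/(qmul _ _) !qmul_coords.
apply/rowP => k; rewrite !mxE /=.
case: k => -[|[|[|[|]]]] hk //=;
  by rewrite !(rmorphD, rmorphB, rmorphN, rmorphM).
Qed.

HB.instance Definition _ :=
  GRing.isZmodMorphism.Build (qring F) (qring FS) qring_map qring_map_additive.
HB.instance Definition _ :=
  GRing.isMonoidMorphism.Build (qring F) (qring FS) qring_map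
    qring_map_multiplicative.

Section Extend.
Variables (A : comAlgType S) (g : {rmorphism qring F -> A}).

Definition qring_extend (x : qring FS) : A :=
  \sum_(k < 4) x 0 k *: g (qbasis F k).

Fact qring_extend_linear : linear qring_extend.
Proof.
move=> a x y; rewrite /qring_extend scaler_sumr -big_split /=.
by apply: eq_bigr => k _; rewrite !mxE scalerDl scalerA.
Qed.
HB.instance Definition _ := GRing.isLinear.Build S (qring FS) A _ qring_extend
  qring_extend_linear.

Lemma qring_extendK x : qring_extend (qring_map x) = g x.
Proof.
rewrite [in RHS](qbasisE x) raddf_sum; apply: eq_bigr => k _ /=.
by rewrite mxE -[in RHS](intz (x 0 k)) !scaler_int raddfMz.
Qed.

Fact qring_extend_multiplicative : monoid_morphism qring_extend.
Proof.
split=> [|x y].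
  by rewrite -(rmorph1 qring_map) qring_extendK rmorph1.
rewrite {1}(qbasisE x) {1}(qbasisE y) mulr_suml raddf_sum /=.
rewrite [in RHS]/qring_extend mulr_suml; apply: eq_bigr => i _.
rewrite !mulr_sumr raddf_sum /=; apply: eq_bigr => j _.
have e : qring_extend (qbasis FS i * qbasis FS j) =
    g (qbasis F i) * g (qbasis F j).
  rewrite -!qring_map_basis -(rmorphM g) -qring_extendK.
  by congr qring_extend; rewrite (rmorphM qring_map).
have extZ a u : qring_extend (a *: u) = a *: qring_extend u.
  exact: linearZ_LR.
by rewrite -!scalerAl -!scalerAr !extZ e.
Qed.
HB.instance Definition _ :=
  GRing.isMonoidMorphism.Build (qring FS) A qring_extend
    qring_extend_multiplicative.

End Extend.

Lemma qring_tensorZ : is_tensorZ (qring_map : {rmorphism qring F -> qring FS}).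
Proof.
move=> A g; split.
  by exists (qring_extend g : {lrmorphism qring FS -> A}); apply: qring_extendK.
move=> h1 h2 eq_h z; rewrite (qbasisE z) !linear_sum; apply: eq_bigr => k _.
rewrite (linearZ_LR h1) (linearZ_LR h2) -qring_map_basis.
by congr (_ *: _); apply: eq_h.
Qed.

End BaseChange.

Definition is_quartic_ring (R : comNzRingType) (Q : comAlgType R) : Prop :=
  inhabited (Vector.axiom 4 Q).

Lemma qring_quartic (R : comNzRingType) (F : binary_quartic R) :
  is_quartic_ring (qring F).
Proof.
by constructor; exists (fun x : qring F => x : 'rV_4) => //; exists id.
Qed.

(* A quartic ring properly contains Q, up to isomorphism over Q, when it is the
   target of an injective, non surjective R-algebra morphism from Q. *)
Definition maximal_quartic_ring (R : comNzRingType) (Q : comAlgType R) : Prop :=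
  is_quartic_ring Q /\
  forall (Q' : comAlgType R) (f : {lrmorphism Q -> Q'}),
    is_quartic_ring Q' -> injective f -> forall y, exists x, y = f x.

Definition maximal_at (p : nat) (Q : comNzRingType) : Prop :=
  exists (T : comAlgType (padic_int p)) (i : {rmorphism Q -> T}),
    is_tensorZ i /\ maximal_quartic_ring T.

(* Main.v *)
(* Write Q for Q_F over Z_p, with basis 1, z1, z2, z3.  A failing congruence
   makes F divisible by p, or gives it a multiple root modulo p that lifts too
   well modulo p^2; then some lattice J with p Q <= J and J J <= p J is strictly
   larger than p Q, and (1/p) J is an overring of Q.

   Conversely let f : Q -> Q' be an injective, non surjective morphism of
   quartic rings.  Its determinant is not a unit, so I = f^-1(p Q') is strictly
   larger than p Q.  It is a proper ideal, nilpotent modulo p by Cayley-Hamilton,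
   and a, b in I with a b = p c imply c in I.  In each residual factorization
   type of F, an element of I outside p Q yields an explicit element of I whose
   square is p times an element that cannot belong to I, because A, C, A + B + C
   or B^2 - 4AC is divisible by p but not by p^2.  Only integers modulo p are
   involved, so these computations take place in any ring with a basis
   satisfying the multiplication table of Q_F; exchanging x and y is then a
   change of basis. *)

Require Import Defs.
From HB Require Import structures.
From mathcomp Require Import all_boot all_order all_algebra.
From mathcomp Require Import boolp ring zify.
Set Implicit Arguments.
Unset Strict Implicit.
Unset Printing Implicit Defensive.
Import GRing.Theory.
Local Open Scope ring_scope.

(** * Divisibility by a prime, and the ideals of overrings *)

Lemma Euclid_dvdzM (p : nat) (m n : int) : prime p ->
  (p %| m * n)%Z = (p %| m)%Z || (p %| n)%Z.
Proof. by move=> pp; rewrite !dvdzE abszM Euclid_dvdM. Qed.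

Lemma Euclid_dvdzX (p : nat) (m : int) k : prime p -> (p %| m ^+ k)%Z -> (p %| m)%Z.
Proof. by move=> pp; rewrite !dvdzE abszX Euclid_dvdX //; case/andP. Qed.

Lemma coprimez_prime (p : nat) (m : int) : prime p ->
  coprimez p m = ~~ (p %| m)%Z.
Proof. by move=> pp; rewrite coprimezE prime_coprime. Qed.

Lemma coprimez_inv (q m : int) : coprimez q m -> exists u v, m * u = 1 + q * v.
Proof.
by case/coprimezP=> [[u v] /= e]; exists v, (- u); rewrite -e; ring.
Qed.

(** For an overring f : Q -> Q' these are properties of the preimage of p Q'. If f a = p y, then
    Cayley-Hamilton for y, in rank 4, makes a^4 a multiple of p. If also f b = p y', then a b = p c
    gives f c = p y y', as p is regular in Q'. *)
Record overring_ideal (p : nat) (Q : comNzRingType) (I : Q -> Prop) : Prop := {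
  oiD : forall a b, I a -> I b -> I (a + b);
  oiM : forall q a, I a -> I (q * a);
  oi_p : I p%:~R;
  oi_neq1 : ~ I 1;
  oi_nilp : forall a, I a -> exists b, a ^+ 4 = p%:~R * b;
  oi_div : forall a b c, I a -> I b -> a * b = p%:~R * c -> I c
}.

Section OverringIdeal.
Variables (p : nat) (Q : comNzRingType) (I : Q -> Prop).
Hypotheses (pp : prime p) (HI : overring_ideal p I).
Local Notation P := (p%:~R : Q).

Lemma oi_cong a q b : I a -> a = b + P * q -> I b.
Proof.
move=> Ia e; have -> : b = a + - q * P by rewrite e; ring.
by apply: (oiD HI) => //; apply/(oiM HI)/(oi_p HI).
Qed.

Lemma oiN a : I a -> I (- a).
Proof. by rewrite -mulN1r; apply: (oiM HI). Qed.

Lemma oiB a b : I a -> I b -> I (a - b).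
Proof. by move=> Ia Ib; apply: (oiD HI) => //; apply: oiN. Qed.

Lemma oi_cancel (n : int) a : ~~ (p %| n)%Z -> I (n%:~R * a) -> I a.
Proof.
rewrite -coprimez_prime // => /coprimez_inv[u [v e]] Ia.
apply: (@oi_cong (u%:~R * (n%:~R * a)) (v%:~R * a)); first exact: (oiM HI).
by rewrite mulrA -intrM (mulrC u) e; ring.
Qed.

Lemma oi_int (n : int) : I n%:~R -> (p %| n)%Z.
Proof.
move=> In; apply: contraT => pn.
by case: (oi_neq1 HI); apply: (oi_cancel pn); rewrite mulr1.
Qed.

Lemma p_cancel (n : int) (a b : Q) : ~~ (p %| n)%Z -> n%:~R * a = P * b ->
  exists c, a = P * c.
Proof.
rewrite -coprimez_prime // => /coprimez_inv[u [v e]] ab.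
exists (u%:~R * b - v%:~R * a).
have h : (n * u)%:~R * a = P * (u%:~R * b) by rewrite mulrCA -ab; ring.
by rewrite mulrBr -h e; ring.
Qed.

(* Modulo p, [u / m] is idempotent as well as nilpotent. *)
Lemma oi_idem (m : int) u q : ~~ (p %| m)%Z -> I u -> u * u = m%:~R * u + P * q ->
  exists v, u = P * v.
Proof.
move=> pm Iu e; have [b u4] := oi_nilp HI Iu.
(* Squaring the relation, u^4 is m^3 u plus multiples of p; the witness collects them. *)
apply: (@p_cancel (m ^+ 3) _ (b - m%:~R ^+ 2 * q - 2 * m%:~R * u * q - P * q ^+ 2)).
  by apply: contra pm => /(Euclid_dvdzX pp).
rewrite !mulrBr -u4 (_ : u ^+ 4 = (u * u) * (u * u)); last by ring.
have -> : (m ^+ 3)%:~R * u = m%:~R ^+ 2 * (m%:~R * u) by ring.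
have -> : m%:~R * u = u * u - P * q by rewrite e; ring.
rewrite !e; ring: e.
Qed.
End OverringIdeal.

(** The table of zeta_1, zeta_2, zeta_3 for A x^4 + B x^2 y^2 + C y^4. The last two fields say that,
    together with 1, these form a basis of Q / p Q over F_p, in terms of integers only. *)
Record qpres (p : nat) (A B C : int) (Q : comNzRingType) (z1 z2 z3 : Q) : Prop := {
  z11 : z1 * z1 = A%:~R * z2;
  z12 : z1 * z2 = - B%:~R * z1 + A%:~R * z3;
  z13 : z1 * z3 = - (A * C)%:~R;
  z22 : z2 * z2 = - (A * C)%:~R - B%:~R * z2;
  z23 : z2 * z3 = - C%:~R * z1;
  z33 : z3 * z3 = - (B * C)%:~R - C%:~R * z2;
  qgen : forall q, exists n0 n1 n2 n3 : int, exists r,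
    q = n0%:~R + n1%:~R * z1 + n2%:~R * z2 + n3%:~R * z3 + p%:~R * r;
  qfree : forall (n0 n1 n2 n3 : int) r,
    n0%:~R + n1%:~R * z1 + n2%:~R * z2 + n3%:~R * z3 = p%:~R * r ->
    [/\ (p %| n0)%Z, (p %| n1)%Z, (p %| n2)%Z & (p %| n3)%Z]
}.

(** With t a root of F(x, 1), the elements attached to the reversed form and 1/t are C/t = -(A t^3 +
    B t), C/t^2 = -(A t^2 + B) and C/t^3 + B/t = -A t. *)
Lemma qpres_rev p A B C (Q : comNzRingType) (z1 z2 z3 : Q) :
  qpres p A B C z1 z2 z3 -> qpres p C B A (- z3) (- z2 - B%:~R) (- z1).
Proof.
move=> [h11 h12 h13 h22 h23 h33 gen free]; split.
- ring: h33.
- ring: h23.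
- ring: h13.
- ring: h22.
- ring: h12.
- ring: h11.
- move=> q; have [n0 [n1 [n2 [n3 [r ->]]]]] := gen q.
  by exists (n0 - B * n2), (- n3), (- n2), (- n1), r; ring.
- move=> n0 n1 n2 n3 r e.
  have [|p0] := free (n0 - B * n2) (- n3) (- n2) (- n1) r; first by rewrite -e; ring.
  rewrite !dvdzE !abszN -!dvdzE => p3 p2 p1; split=> //.
  by rewrite -(subrK (B * n2) n0) rpredD ?dvdz_mull.
Qed.

(** * Maximality from congruences *)

Section MaximalCases.
Variables (p : nat) (A B C : int) (Q : comNzRingType) (z1 z2 z3 : Q).
Variable I : Q -> Prop.
Hypotheses (pp : prime p) (HI : overring_ideal p I).
Hypothesis HQ : qpres p A B C z1 z2 z3.
Local Notation P := (p%:~R : Q).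
Let r11 := z11 HQ.
Let r12 := z12 HQ.
Let r13 := z13 HQ.
Let r22 := z22 HQ.
Let r23 := z23 HQ.
Let r33 := z33 HQ.

Definition qlin (n0 n1 n2 n3 : int) : Q :=
  n0%:~R + n1%:~R * z1 + n2%:~R * z2 + n3%:~R * z3.

Lemma z1M n0 n1 n2 n3 : z1 * qlin n0 n1 n2 n3 =
  qlin (- (A * C * n3)) (n0 - B * n2) (A * n1) (A * n2).
Proof.
transitivity (n0%:~R * z1 + n1%:~R * (z1 * z1) + n2%:~R * (z1 * z2)
  + n3%:~R * (z1 * z3)); first by rewrite /qlin; ring.
by rewrite r11 r12 r13 /qlin; ring.
Qed.

Lemma z2M n0 n1 n2 n3 : z2 * qlin n0 n1 n2 n3 =
  qlin (- (A * C * n2)) (- (B * n1) - C * n3) (n0 - B * n2) (A * n1).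
Proof.
transitivity (n0%:~R * z2 + n1%:~R * (z1 * z2) + n2%:~R * (z2 * z2)
  + n3%:~R * (z2 * z3)); first by rewrite /qlin; ring.
by rewrite r12 r22 r23 /qlin; ring.
Qed.

Lemma z3M n0 n1 n2 n3 : z3 * qlin n0 n1 n2 n3 =
  qlin (- (A * C * n1) - B * C * n3) (- (C * n2)) (- (C * n3)) n0.
Proof.
transitivity (n0%:~R * z3 + n1%:~R * (z1 * z3) + n2%:~R * (z2 * z3)
  + n3%:~R * (z3 * z3)); first by rewrite /qlin; ring.
by rewrite r13 r23 r33 /qlin; ring.
Qed.

Lemma qlinM n0 n1 n2 n3 m0 m1 m2 m3 : qlin n0 n1 n2 n3 * qlin m0 m1 m2 m3 =
  qlin (n0 * m0 - A * C * (n1 * m3 + n2 * m2 + n3 * m1) - B * C * n3 * m3)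
    (n0 * m1 + n1 * m0 - B * (n1 * m2 + n2 * m1) - C * (n2 * m3 + n3 * m2))
    (n0 * m2 + n2 * m0 + A * n1 * m1 - B * n2 * m2 - C * n3 * m3)
    (n0 * m3 + n3 * m0 + A * (n1 * m2 + n2 * m1)).
Proof.
have E x : qlin n0 n1 n2 n3 * x =
    n0%:~R * x + n1%:~R * (z1 * x) + n2%:~R * (z2 * x) + n3%:~R * (z3 * x).
  by rewrite /qlin; ring.
by rewrite E z1M z2M z3M /qlin; ring.
Qed.

Lemma p_dvdz_qlin n0 n1 n2 n3 q : qlin n0 n1 n2 n3 = P * q ->
  [/\ (p %| n0)%Z, (p %| n1)%Z, (p %| n2)%Z & (p %| n3)%Z].
Proof. exact: (qfree HQ). Qed.

Lemma p_dvdz1 : (p %| 1)%Z = false.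
Proof. by rewrite dvdzE dvdn1; case: (p) pp => [|[|]]. Qed.

(** z3^2 = -C (B + z2), where C is p times an integer prime to p. *)
Lemma oi_z3_z2 : (p %| C)%Z -> ~~ (p ^+ 2 %| C)%Z -> I z3 -> I (B%:~R + z2).
Proof.
case/dvdzP=> C' eC pC Iz3.
have pC' : ~~ (p %| C')%Z.
  by apply: contra pC => /dvdzP[c ec]; rewrite eC ec -mulrA dvdz_mull.
apply: (oi_cancel pp HI pC'); rewrite -[_ * _]opprK; apply: (oiN HI).
by apply: (oi_div HI Iz3 Iz3); have := r33; rewrite eC => h; ring: h.
Qed.

(** u = B + z2 satisfies u^2 = B u - A C, so [oi_idem] would make it 0 modulo p, although its
    coordinate on z2 is 1. *)
Lemma oi_z3 : (p %| C)%Z -> ~~ (p ^+ 2 %| C)%Z -> ~ [/\ I z3 & ~~ (p %| B)%Z].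
Proof.
move=> pC pC2 [/(oi_z3_z2 pC pC2) Iu pB]; have /dvdzP[C' eC] := pC.
have [|v e] := oi_idem (q := - (A * C')%:~R) pp HI pB Iu.
  by have := r22; rewrite eC => h; ring: h.
have /p_dvdz_qlin[_ _] : qlin B 0 1 0 = P * v by rewrite -e /qlin; ring.
by rewrite p_dvdz1.
Qed.

(** Modulo p, F is A x^4 and Q becomes F_p[t]/(t^4), with socle spanned by z3; so I would contain
    z3. Then it contains B + z2 and z2, whose product -A C is p times an integer prime to p. *)
Lemma maximal_eisenstein n0 n1 n2 n3 :
  (p %| B)%Z -> (p %| C)%Z -> ~~ (p %| A)%Z -> ~~ (p ^+ 2 %| C)%Z ->
  I (qlin n0 n1 n2 n3) ->
  [/\ (p %| n0)%Z, (p %| n1)%Z, (p %| n2)%Z & (p %| n3)%Z].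
Proof.
move=> /dvdzP[B' eB] pC pA pC2 Ia; have /dvdzP[C' eC] := pC.
have pC' : ~~ (p %| C')%Z.
  by apply: contra pC2 => /dvdzP[c ec]; rewrite eC ec -mulrA dvdz_mull.
have nIz3 : ~ I z3.
  move=> /(oi_z3_z2 pC pC2) Iu.
  have Iz2 : I z2 by apply: (oi_cong HI (q := B'%:~R) Iu); rewrite eB; ring.
  have : I (- (A * C')%:~R).
    by apply: (oi_div HI Iz2 Iu); have := r22; rewrite eC => h; ring: h.
  rewrite -intrN => /(oi_int pp HI).
  by rewrite dvdzE abszN -dvdzE Euclid_dvdzM // (negPf pA) (negPf pC').
have IaM z := oiM HI z Ia.
(* Multiplying by z3, z2, z1 and 1 in turn leaves n0, A n1, A n2 and n3 times z3 modulo p. *)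
case p0 : (p %| n0)%Z; last first.
  case: nIz3; apply: (oi_cancel pp HI (negbT p0)).
  apply: (oi_cong HI (q := - (n1 * A * C')%:~R - (n2 * C')%:~R * z1
     - (n3 * C')%:~R * (B%:~R + z2)) (IaM z3)).
  by rewrite z3M /qlin eB eC; ring.
have /dvdzP[m0 e0] := p0.
case p1 : (p %| n1)%Z; last first.
  case: nIz3; apply: (oi_cancel (n := A * n1) pp HI).
    by rewrite Euclid_dvdzM // negb_or pA p1.
  apply: (oi_cong HI (q := m0%:~R * z2 - (n1 * B')%:~R * z1
     - n2%:~R * (A * C')%:~R - (n2 * B')%:~R * z2 - (n3 * C')%:~R * z1) (IaM z2)).
  by rewrite z2M /qlin e0 eB eC; ring.
have /dvdzP[m1 e1] := p1.
case p2 : (p %| n2)%Z; last first.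
  case: nIz3; apply: (oi_cancel (n := A * n2) pp HI).
    by rewrite Euclid_dvdzM // negb_or pA p2.
  apply: (oi_cong HI (q := m0%:~R * z1 + (m1 * A)%:~R * z2
     - (n2 * B')%:~R * z1 - (n3 * A * C')%:~R) (IaM z1)).
  by rewrite z1M /qlin e0 e1 eB eC; ring.
have /dvdzP[m2 e2] := p2.
case p3 : (p %| n3)%Z => //.
case: nIz3; apply: (oi_cancel pp HI (negbT p3)).
apply: (oi_cong HI (q := m0%:~R + m1%:~R * z1 + m2%:~R * z2) Ia).
by rewrite /qlin e0 e1 e2; ring.
Qed.

(** Modulo p, F is B x^2 y^2, and the idempotent -z2 / B splits Q / p Q into two local rings with
    socles spanned by z1 and z3. [oi_z3] excludes z3 from I, while z1^2 = A z2 would lead from z1 to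
    z2, an idempotent up to a unit. *)
Lemma maximal_mid n0 n1 n2 n3 :
  (p %| A)%Z -> (p %| C)%Z -> ~~ (p %| B)%Z ->
  ~~ (p ^+ 2 %| A)%Z -> ~~ (p ^+ 2 %| C)%Z ->
  I (qlin n0 n1 n2 n3) ->
  [/\ (p %| n0)%Z, (p %| n1)%Z, (p %| n2)%Z & (p %| n3)%Z].
Proof.
move=> pA pC pB pA2 pC2 Ia.
have nIz3 : ~ I z3 by move=> Iz3; apply: (oi_z3 pC pC2).
have /dvdzP[A' eA] := pA; have /dvdzP[C' eC] := pC.
have pA' : ~~ (p %| A')%Z.
  by apply: contra pA2 => /dvdzP[c ec]; rewrite eA ec -mulrA dvdz_mull.
move: r11 r12 r13 r22 r23 r33; rewrite eA eC => s11 s12 s13 s22 s23 s33.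
have nIz1 : ~ I z1.
  move=> Iz1.
  have Iz2 : I z2.
    apply: (oi_cancel pp HI pA').
    by apply: (oi_div HI Iz1 Iz1); ring: s11.
  have pNB : ~~ (p %| - B)%Z by rewrite dvdzE abszN.
  have [|v e] := oi_idem (q := - (A' * C' * p%:Z)%:~R) pp HI pNB Iz2.
    by ring: s22.
  have /p_dvdz_qlin[_ _] : qlin 0 0 1 0 = P * v by rewrite -e /qlin; ring.
  by rewrite p_dvdz1.
have IaM z := oiM HI z Ia.
case p0 : (p %| n0)%Z; last first.
  case: nIz3; apply: (oi_cancel pp HI (negbT p0)).
  apply: (oi_cong HI (q := - (n1 * A' * C' * p%:Z)%:~R - (n2 * C')%:~R * z1
     - (n3 * C')%:~R * (B%:~R + z2)) (IaM z3)).
  by rewrite z3M /qlin eA eC; ring.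
have /dvdzP[m0 e0] := p0.
case p2 : (p %| n2)%Z; last first.
  case: nIz1; apply: (oi_cancel (n := - B * n2) pp HI).
    by rewrite Euclid_dvdzM // negb_or p2 andbT dvdzE abszN.
  apply: (oi_cong HI (q := m0%:~R * z1 + (n1 * A')%:~R * z2 + (n2 * A')%:~R * z3
     - (n3 * A' * C' * p%:Z)%:~R) (IaM z1)).
  by rewrite z1M /qlin e0 eA eC; ring.
have /dvdzP[m2 e2] := p2.
case p1 : (p %| n1)%Z; last first.
  case: nIz1; apply: (oi_cancel (n := - B * n1) pp HI).
    by rewrite Euclid_dvdzM // negb_or p1 andbT dvdzE abszN.
  apply: (oi_cong HI (q := m0%:~R * z2 + (n1 * A')%:~R * z3
     - m2%:~R * ((A * C)%:~R + B%:~R * z2)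
     - (n3 * C')%:~R * z1) (IaM z2)).
  by rewrite z2M /qlin e0 e2 eA eC; ring.
have /dvdzP[m1 e1] := p1.
case p3 : (p %| n3)%Z => //.
case: nIz3; apply: (oi_cancel pp HI (negbT p3)).
apply: (oi_cong HI (q := m0%:~R + m1%:~R * z1 + m2%:~R * z2) Ia).
by rewrite /qlin e0 e1 e2; ring.
Qed.

Lemma p_odd2 : odd p -> ~~ (p %| 2)%Z.
Proof.
by move=> p_odd; rewrite dvdzE dvdn_prime2 //; apply: contraL p_odd => /eqP /= ->.
Qed.

(** In terms of a root of F(x, 1), 1 and z2 are even and z1 and z3 are odd; this is the
    corresponding grading. *)
Let ev (x : Q) := exists n0 n2, x = qlin n0 0 n2 0.
Let od (x : Q) := exists n1 n3, x = qlin 0 n1 0 n3.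

Let evD x y : ev x -> ev y -> ev (x + y).
Proof.
by move=> [a [b ->]] [c [d ->]]; exists (a + c), (b + d); rewrite /qlin; ring.
Qed.

Let odD x y : od x -> od y -> od (x + y).
Proof.
by move=> [a [b ->]] [c [d ->]]; exists (a + c), (b + d); rewrite /qlin; ring.
Qed.

Let ev_ev x y : ev x -> ev y -> ev (x * y).
Proof.
move=> [a [b ->]] [c [d ->]]; rewrite qlinM.
by exists (a * c - b * A * C * d), (a * d + b * c - b * B * d); rewrite /qlin; ring.
Qed.

Let ev_od x y : ev x -> od y -> od (x * y).
Proof.
move=> [a [b ->]] [c [d ->]]; rewrite qlinM.
by exists (a * c - b * B * c - b * C * d), (a * d + A * b * c); rewrite /qlin; ring.
Qed.

Let od_od x y : od x -> od y -> ev (x * y).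
Proof.
move=> [a [b ->]] [c [d ->]]; rewrite qlinM.
exists (- a * A * C * d - b * A * C * c - b * B * C * d), (a * A * c - b * C * d).
by rewrite /qlin; ring.
Qed.

Let ev_odX x y q : ev x -> od y -> x + y = P * q ->
  (exists q1, x = P * q1) /\ (exists q2, y = P * q2).
Proof.
move=> [a [b ->]] [c [d ->]] e.
have /p_dvdz_qlin[/dvdzP[a' ->] /dvdzP[c' ->] /dvdzP[b' ->] /dvdzP[d' ->]] :
  qlin a c b d = P * q by rewrite -e /qlin; ring.
by split; [exists (qlin a' 0 b' 0)|exists (qlin 0 c' 0 d')]; rewrite /qlin; ring.
Qed.

(* The substitution x |-> -x induces an automorphism of the ring, under which
   the nilradical modulo p is stable; so the part in the span of 1 and z2 of a
   nilpotent element is nilpotent, and its trace is 2 n0 - B n2. *)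
Lemma oi_trace n0 n1 n2 n3 : odd p -> I (qlin n0 n1 n2 n3) ->
  (p %| n0 *+ 2 - B * n2)%Z.
Proof.
move=> p_odd Ia; have [q] := oi_nilp HI Ia.
have p2 := p_odd2 p_odd.
pose b := qlin n0 0 n2 0; pose c := qlin 0 n1 0 n3.
have evb : ev b by exists n0, n2.
have odc : od c by exists n1, n3.
have -> : qlin n0 n1 n2 n3 = b + c by rewrite /b /c /qlin; ring.
move=> e.
(* The even part b^4 + 6 b^2 c^2 + c^4 and the odd part 4 (b^2 + c^2) b c of (b + c)^4 are
   separately multiples of p. *)
have [|||[q1 e1] [q2 e2]] := @ev_odX
    (b * b * (b * b) + (b * b * (c * c) + (b * b * (c * c) + (b * b * (c * c)
     + (b * b * (c * c) + (b * b * (c * c) + (b * b * (c * c) + c * c * (c * c))))))))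
    ((b * b + c * c) * (b * c) + ((b * b + c * c) * (b * c)
     + ((b * b + c * c) * (b * c) + (b * b + c * c) * (b * c)))) q.
- have evbb := ev_ev evb evb; have evcc := od_od odc odc.
  by do !apply: evD; apply: ev_ev.
- have evbc : ev (b * b + c * c) by apply: evD; [apply: ev_ev|apply: od_od].
  by have odbc := ev_od evb odc; do !apply: odD; apply: ev_od.
- by rewrite -e; ring.
have e' : (b - c) ^+ 4 = P * (q1 - q2) by rewrite mulrBr -e1 -e2; ring.
(* 2 b is the sum of b + c and b - c, whose fourth powers are multiples of p; every term of the
   seventh power of this sum contains one of them. *)
have [r er] : exists r, (b * 2) ^+ 7 = P * r.
  pose x := b + c; pose y := b - c.
  exists (q * (x ^+ 3 + 7 * x ^+ 2 * y + 21 * x * y ^+ 2 + 35 * y ^+ 3)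
    + (q1 - q2) * (y ^+ 3 + 7 * y ^+ 2 * x + 21 * y * x ^+ 2 + 35 * x ^+ 3)).
  transitivity ((x + y) ^+ 7); first by rewrite /x /y; ring.
  transitivity (x ^+ 4 * (x ^+ 3 + 7 * x ^+ 2 * y + 21 * x * y ^+ 2 + 35 * y ^+ 3)
    + y ^+ 4 * (y ^+ 3 + 7 * y ^+ 2 * x + 21 * y * x ^+ 2 + 35 * x ^+ 3)).
    ring.
  by rewrite [x ^+ 4]e [y ^+ 4]e'; ring.
have [s es] : exists s, b ^+ 7 = P * s.
  apply: (@p_cancel p Q pp (2 ^+ 7) _ r); last by rewrite -er; ring.
  by apply: contra p2 => /(Euclid_dvdzX pp).
(* Trace and norm of [b] in the quadratic ring spanned by 1 and z2: b (t - b) = N, so p divides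
   N^7. *)
pose t := n0 *+ 2 - B * n2; pose N := n0 ^+ 2 - B * n0 * n2 + A * C * n2 ^+ 2.
have bt : b * b = t%:~R * b - N%:~R.
  by rewrite /b qlinM /t /N /qlin; ring.
have pN : (p %| N)%Z.
  apply: (Euclid_dvdzX (k := 7) pp).
  have [|->//] := @p_dvdz_qlin (N ^+ 7) 0 0 0 (s * (t%:~R - b) ^+ 7).
  rewrite mulrA -es -exprMn (_ : b * (t%:~R - b) = N%:~R) /qlin; first by ring.
  by rewrite mulrBr bt; ring.
(* Modulo p, b^2 = t b, hence b^7 = t^6 b. If t is prime to p, then b vanishes modulo p, and so does
   its trace t. *)
apply: contraT => pt.
have /dvdzP[N' eN] := pN.
have bt' : b * b = t%:~R * b - P * N'%:~R by rewrite bt eN; ring.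
have step k x : b ^+ k.+1 = t%:~R ^+ k * b + P * x ->
    exists y, b ^+ k.+2 = t%:~R ^+ k.+1 * b + P * y.
  move=> ek; exists (x * b - t%:~R ^+ k * N'%:~R).
  rewrite exprSr ek mulrDl -(mulrA _ b b) bt' exprSr; ring.
have [|x1 /step[x2 /step[x3 /step[x4 /step[x5 /step[x6]]]]]] := step 0%N 0.
  by rewrite expr1 expr0; ring.
rewrite es => E.
have [v ev7] : exists v, b = P * v.
  apply: (@p_cancel p Q pp (t ^+ 6) _ (s - x6)).
    by apply: contra pt => /(Euclid_dvdzX pp).
  by rewrite mulrBr E; ring.
have [p0 _ pn2 _] := p_dvdz_qlin ev7.
by case/negP: pt; apply: rpredB; [exact: rpredMn|exact: dvdz_mull].
Qed.

(** [oi_trace] for a and for its multiples by z1, z2, z3; the second congruence eliminates n0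
    between those for a and z2 a. *)
Lemma oi_traces n0 n1 n2 n3 : odd p -> I (qlin n0 n1 n2 n3) ->
  [/\ (p %| n0 *+ 2 - B * n2)%Z, (p %| (B ^+ 2 - 4 * A * C) * n2)%Z,
      (p %| A * (B * n1 + C * n3 *+ 2))%Z & (p %| C * (A * n1 *+ 2 + B * n3))%Z].
Proof.
move=> p_odd Ia; have t0 := oi_trace p_odd Ia.
have:= oiM HI z1 Ia; rewrite z1M => /(oi_trace p_odd) t1.
have:= oiM HI z2 Ia; rewrite z2M => /(oi_trace p_odd) t2.
have:= oiM HI z3 Ia; rewrite z3M => /(oi_trace p_odd) t3.
split=> //.
- have := dvdz_mull B t0; have := dvdz_mull 2 t2 => d2 d0.
  by have := rpredD d2 d0; congr (_ %| _)%Z; ring.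
- by rewrite -rpredN; move: t1; congr (_ %| _)%Z; ring.
- by rewrite -rpredN; move: t3; congr (_ %| _)%Z; ring.
Qed.

(** If p does not divide C, the congruences of [oi_traces] form an invertible linear system. If it
    does, B is prime to p and they kill n0, n1 and n2; then n3 prime to p would put z3 into I,
    against [oi_z3]. *)
Lemma maximal_odd_unramified n0 n1 n2 n3 : odd p ->
  ~~ (p %| B ^+ 2 - 4 * A * C)%Z -> ~~ (p %| A)%Z -> ~~ (p ^+ 2 %| C)%Z ->
  I (qlin n0 n1 n2 n3) ->
  [/\ (p %| n0)%Z, (p %| n1)%Z, (p %| n2)%Z & (p %| n3)%Z].
Proof.
move=> p_odd pD pA pC Ia.
have p2 := p_odd2 p_odd.
have cancel m n : ~~ (p %| m)%Z -> (p %| m * n)%Z -> (p %| n)%Z.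
  by move=> pm; rewrite Euclid_dvdzM // (negPf pm).
have [d0 /(cancel _ _ pD) pn2 /(cancel _ _ pA) d1 d3] := oi_traces p_odd Ia.
have pn0 : (p %| n0)%Z.
  apply: (cancel 2) => //; rewrite -(subrK (B * n2) (2 * n0)) rpredD ?dvdz_mull //.
  by move: d0; congr (_ %| _)%Z; ring.
have [pC'|pC'] := boolP (p %| C)%Z; last first.
  have {}d3 := cancel _ _ pC' d3.
  have pn3 : (p %| n3)%Z.
    apply: (cancel _ _ pD); have := rpredB (dvdz_mull B d3) (dvdz_mull (A *+ 2) d1).
    by congr (_ %| _)%Z; ring.
  split=> //; apply: (cancel 2) => //; apply: (cancel A) => //.
  by have := rpredB d3 (dvdz_mull B pn3); congr (_ %| _)%Z; ring.
have pB : ~~ (p %| B)%Z.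
  by apply: contra pD => pB; apply: rpredB; [exact: dvdz_mulr|exact: dvdz_mull].
have pn1 : (p %| n1)%Z.
  apply: (cancel _ _ pB); have := rpredB d1 (dvdz_mulr (n3 *+ 2) pC').
  by congr (_ %| _)%Z; ring.
split=> //; apply: contraT => pn3; case: (oi_z3 pC' pC); split=> //.
move: pn0 pn1 pn2 => /dvdzP[m0 e0] /dvdzP[m1 e1] /dvdzP[m2 e2].
apply: (oi_cancel pp HI pn3).
apply: (oi_cong HI (q := m0%:~R + m1%:~R * z1 + m2%:~R * z2) Ia).
by rewrite /qlin e0 e1 e2; ring.
Qed.

(** Modulo p, F is A times the square of some x^2 - e y^2. Here w = B + 2 z2 has w^2 = B^2 - 4 A C,
    and the traces make 2 A a congruent to w v with v = A n2 + n3 z1. Dividing (w v)^2 by p puts v^2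
    into I, and the traces of v^2 kill n2 and n3. *)
Lemma maximal_odd_double n0 n1 n2 n3 : odd p ->
  (p %| B ^+ 2 - 4 * A * C)%Z -> ~~ (p ^+ 2 %| B ^+ 2 - 4 * A * C)%Z ->
  ~~ (p %| A)%Z -> ~~ (p %| C)%Z ->
  I (qlin n0 n1 n2 n3) ->
  [/\ (p %| n0)%Z, (p %| n1)%Z, (p %| n2)%Z & (p %| n3)%Z].
Proof.
move=> p_odd /dvdzP[D' eD] pD2 pA pC Ia.
have pD' : ~~ (p %| D')%Z.
  by apply: contra pD2 => /dvdzP[c ec]; rewrite eD ec -mulrA dvdz_mull.
have p2 := p_odd2 p_odd.
have cancel m n : ~~ (p %| m)%Z -> (p %| m * n)%Z -> (p %| n)%Z.
  by move=> pm; rewrite Euclid_dvdzM // (negPf pm).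
have [d0 _ /(cancel _ _ pA) d1 /(cancel _ _ pC) d3] := oi_traces p_odd Ia.
pose w := qlin B 0 2 0; pose v := (A * n2)%:~R + n3%:~R * z1.
have ww : w * w = (B ^+ 2 - 4 * A * C)%:~R.
  by rewrite {1}/w /qlin !mulrDl -!mulrA z2M mul0r !mulr0 /w /qlin; ring.
have Iwv : I (w * v).
  case/dvdzP: d0 => m0 e0; case/dvdzP: d3 => m3 e3.
  apply: (oi_cong HI (q := (A * m0)%:~R + m3%:~R * z1) (oiM HI (2 * A)%:~R Ia)).
  have -> : w * v = (A * n2)%:~R * w + n3%:~R * (z1 * w) by rewrite /v; ring.
  rewrite /w z1M.
  transitivity (qlin (A * (m0 * p) + A * B * n2) (m3 * p - B * n3) (2 * A * n2)
    (2 * A * n3));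
    last by rewrite /qlin; ring.
  by rewrite -e0 -e3 /qlin; ring.
have Ivv : I (qlin ((A * n2) ^+ 2) (2 * A * n2 * n3) (A * n3 ^+ 2) 0).
  apply: (oi_cancel pp HI pD'); apply: (oi_div HI Iwv Iwv).
  rewrite (_ : w * v * (w * v) = w * w * (v * v)); last by ring.
  rewrite ww eD /v (_ : forall x y : Q, (x + y * z1) * (x + y * z1)
    = x ^+ 2 + x * y * z1 *+ 2 + y ^+ 2 * (z1 * z1)); last by move=> *; ring.
  by rewrite r11 /qlin; ring.
have pB : ~~ (p %| B)%Z.
  apply: contra pA => pB; have := rpredB (dvdz_mull B pB) (dvdz_mull D' (dvdzz p)).
  rewrite -eD (_ : _ - _ = 4 * C * A); last by ring.
  apply: cancel; rewrite Euclid_dvdzM // negb_or pC andbT.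
  by rewrite (_ : 4 = 2 * 2) // Euclid_dvdzM // negb_or p2.
have [e0 _ e1 _] := oi_traces p_odd Ivv.
have pn23 : (p %| n2 * n3)%Z.
  move: e1; rewrite (_ : _ * _ = (2 * A * A * B) * (n2 * n3)); last by ring.
  by apply: cancel; rewrite !Euclid_dvdzM // !negb_or p2 pA pB.
have pAn : (p %| (2 * A) * n2 ^+ 2 - B * n3 ^+ 2)%Z.
  by apply: (cancel _ _ pA); move: e0; congr (_ %| _)%Z; ring.
have [pn2 pn3] : (p %| n2)%Z /\ (p %| n3)%Z.
  move: pn23; rewrite Euclid_dvdzM // => /orP[pn2|pn3]; split=> //.
    apply: (@Euclid_dvdzX _ _ 2 pp); apply: (cancel _ _ pB).
    have := rpredB (dvdz_mull (2 * A * n2) pn2) pAn; congr (_ %| _)%Z; ring.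
  apply: (@Euclid_dvdzX _ _ 2 pp); apply: (cancel (2 * A)).
    by rewrite Euclid_dvdzM // negb_or p2.
  have := rpredD (dvdz_mull (B * n3) pn3) pAn; congr (_ %| _)%Z; ring.
split=> //.
  by apply: (cancel 2) => //; have := rpredD d0 (dvdz_mull B pn2); congr (_ %| _)%Z; ring.
apply: (cancel _ _ pB).
have := rpredB d1 (dvdz_mull (C *+ 2) pn3); congr (_ %| _)%Z; ring.
Qed.
End MaximalCases.

(** * The prime 2: parities of coordinates *)

Definition oddz (n : int) : bool := ~~ (2 %| n)%Z.

Lemma oddzN n : oddz (- n) = oddz n.
Proof. by rewrite /oddz; lia. Qed.

Lemma oddzD m n : oddz (m + n) = oddz m (+) oddz n.
Proof. by rewrite /oddz; lia. Qed.

Lemma oddzM m n : oddz (m * n) = oddz m && oddz n.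
Proof. by rewrite /oddz (Euclid_dvdzM (p := 2)) // negb_or. Qed.

Lemma oddz_nat (b : bool) : oddz b%:Z = b.
Proof. by case: b. Qed.

Lemma oddzP n : exists k, n = (oddz n)%:Z + 2 * k.
Proof. by exists (n %/ 2)%Z; rewrite /oddz; lia. Qed.

Definition oddzE := (oddzN, oddzD, oddzM, oddz_nat).

Section MaximalAt2.
Variables (A B C : int) (Q : comNzRingType) (z1 z2 z3 : Q) (I : Q -> Prop).
Hypotheses (HI : overring_ideal 2 I) (HQ : qpres 2 A B C z1 z2 z3).
Local Notation lin := (qlin z1 z2 z3).

(** I contains 2 Q, so only parities of coordinates matter: I becomes a subset of F_2^4 stable under
    z1, z2, z3, and ideals are studied by inspecting 16 vectors. *)
Definition oi_bits (b0 b1 b2 b3 : bool) : Prop := I (lin b0 b1 b2 b3).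

Lemma oi_bitsP n0 n1 n2 n3 :
  I (lin n0 n1 n2 n3) <-> oi_bits (oddz n0) (oddz n1) (oddz n2) (oddz n3).
Proof.
have [[k0 e0] [k1 e1]] := (oddzP n0, oddzP n1).
have [[k2 e2] [k3 e3]] := (oddzP n2, oddzP n3).
rewrite /oi_bits; move: (oddz n0) (oddz n1) (oddz n2) (oddz n3) e0 e1 e2 e3.
move=> b0 b1 b2 b3 -> -> -> ->; split=> Ia.
  by apply: (oi_cong HI (q := lin k0 k1 k2 k3) Ia); rewrite /qlin; ring.
by apply: (oi_cong HI (q := - lin k0 k1 k2 k3) Ia); rewrite /qlin; ring.
Qed.

Lemma oi_bitsD b0 b1 b2 b3 c0 c1 c2 c3 :
  oi_bits b0 b1 b2 b3 -> oi_bits c0 c1 c2 c3 ->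
  oi_bits (b0 (+) c0) (b1 (+) c1) (b2 (+) c2) (b3 (+) c3).
Proof.
move=> Ib Ic; have := oiD HI Ib Ic.
rewrite (_ : _ + _ = lin (b0%:Z + c0%:Z) (b1%:Z + c1%:Z) (b2%:Z + c2%:Z)
  (b3%:Z + c3%:Z)); last by rewrite /qlin; ring.
by move/oi_bitsP; rewrite !oddzE.
Qed.

Lemma oi_bitsM1 b0 b1 b2 b3 : oi_bits b0 b1 b2 b3 ->
  oi_bits (oddz A && oddz C && b3) (b0 (+) (oddz B && b2)) (oddz A && b1) (oddz A && b2).
Proof. by move/(oiM HI z1); rewrite (z1M HQ) => /oi_bitsP; rewrite !oddzE. Qed.

Lemma oi_bitsM2 b0 b1 b2 b3 : oi_bits b0 b1 b2 b3 ->
  oi_bits (oddz A && oddz C && b2) ((oddz B && b1) (+) (oddz C && b3))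
    (b0 (+) (oddz B && b2)) (oddz A && b1).
Proof. by move/(oiM HI z2); rewrite (z2M HQ) => /oi_bitsP; rewrite !oddzE. Qed.

Lemma oi_bitsM3 b0 b1 b2 b3 : oi_bits b0 b1 b2 b3 ->
  oi_bits ((oddz A && oddz C && b1) (+) (oddz B && oddz C && b3)) (oddz C && b2)
    (oddz C && b3) b0.
Proof. by move/(oiM HI z3); rewrite (z3M HQ) => /oi_bitsP; rewrite !oddzE. Qed.

Lemma oi_bits1 : ~ oi_bits true false false false.
Proof. by move=> I1; apply: (oi_neq1 HI); move: I1; congr I; rewrite /qlin /=; ring. Qed.

(* With theta a root of F(x, 1), [s] is (F(theta, 1) - F(-1, 1)) / (theta + 1). *)
Lemma oi_shift (s := lin (- (A + B)) 1 (- 1) 1) m :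
  A + B + C = m *+ 2 -> oddz m -> I s -> I (lin (3 * A + B) (- 2) 1 0).
Proof.
(* Division by theta + 1 gives s = (theta + 1) u - (4 A + 2 B) with u = 3 A + B - 2 z1 + z2, while s
   (theta + 1) = -(A + B + C) = -2 m. *)
move=> eABC m_odd Is; have ss : s * s =
    2%:~R * (- (m%:~R * lin (3 * A + B) (- 2) 1 0) - (2 * A + B)%:~R * s).
  have eC : C = m *+ 2 - A - B by rewrite -eABC; ring.
  transitivity (- (A + B)%:~R * s + z1 * s - z2 * s + z3 * s).
    by rewrite {1}/s /qlin; ring.
  by rewrite /s (z1M HQ) (z2M HQ) (z3M HQ) /qlin eC; ring.
apply: (oi_cancel (p := 2) isT HI m_odd); rewrite -[_ * _]opprK; apply: (oiN HI).
rewrite -[- (_ * _)](subrK ((2 * A + B)%:~R * s)).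
apply: (oiD HI); last exact: (oiM HI).
exact: (oi_div HI Is Is ss).
Qed.

Let bits_case n0 n1 n2 n3 :
  (forall b0 b1 b2 b3, oi_bits b0 b1 b2 b3 -> ~~ [|| b0, b1, b2 | b3]) ->
  I (lin n0 n1 n2 n3) ->
  [/\ (2 %| n0)%Z, (2 %| n1)%Z, (2 %| n2)%Z & (2 %| n3)%Z].
Proof.
move=> H /oi_bitsP/H; rewrite /oddz !negb_or !negbK.
by case/and4P.
Qed.

(** Modulo 2, F is x^2 (x + y)^2, and Q / 2 Q is a product of local rings with socles spanned by z3
    and by the [s] of [oi_shift]. The former is excluded by [oi_z3]; the latter would bring z2,
    idempotent modulo 2, into I. *)
Lemma maximal2_110 n0 n1 n2 n3 : oddz A -> oddz B -> ~~ oddz C ->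
  ~~ (4 %| C)%Z -> ~~ (4 %| A + B + C)%Z ->
  I (lin n0 n1 n2 n3) ->
  [/\ (2 %| n0)%Z, (2 %| n1)%Z, (2 %| n2)%Z & (2 %| n3)%Z].
Proof.
move=> oA oB oC C4 ABC4; have eC := negPf oC.
have nz3 : ~ oi_bits false false false true.
  move=> Ib; apply: (@oi_z3 2 _ _ _ _ _ _ _ I isT HI HQ).
  - by move: oC; rewrite negbK.
  - exact: C4.
  - by split; [move: Ib; congr I; rewrite /qlin /=; ring|].
have ns : ~ oi_bits false true true true.
  move=> Ib; have [m eABC] : exists m, A + B + C = m *+ 2.
    by exists ((A + B + C) %/ 2)%Z; move: oA oB oC; rewrite /oddz; lia.
  have om : oddz m by move: ABC4; rewrite eABC /oddz; lia.
  have Is : I (lin (- (A + B)) 1 (- 1) 1) by apply/oi_bitsP; rewrite !oddzE oA oB.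
  have /oi_bitsP := oi_shift eABC om Is; rewrite !oddzE oA oB => Iz2.
  have {}Iz2 : I z2 by move: Iz2; congr I; rewrite /qlin /=; ring.
  have [c ec] := oddzP C; rewrite eC add0r in ec.
  have oNB : oddz (- B) by rewrite oddzN.
  have [|v e] := @oi_idem 2 Q I isT HI (- B) z2 (- (A * c)%:~R) oNB Iz2.
    by rewrite (z22 HQ) ec; ring.
  have [|_ _ //] := @p_dvdz_qlin 2 _ _ _ _ _ _ _ HQ 0 0 1 0 v.
  by rewrite -e /qlin; ring.
apply: bits_case => b0 b1 b2 b3 H; apply/negP => b_neq0.
have := oi_bitsM1 H; have := oi_bitsM2 H; have := oi_bitsM3 H.
rewrite oA oB eC => H3 H2 H1; have H12 := oi_bitsD H1 H2.
by case: b0 b1 b2 b3 b_neq0 H H1 H2 H3 H12 => -[] [] [] //=.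
Qed.

(** Modulo 2, F is (x + y)^4 and the socle is spanned by the [s] of [oi_shift]. From s in I follows
    u = A + z2 in I; as u^2 is twice (A - B/2) u - A (m - B), the odd integer A (m - B) would lie in
    I. *)
Lemma maximal2_101 n0 n1 n2 n3 : oddz A -> ~~ oddz B -> oddz C ->
  ~~ (4 %| A + B + C)%Z ->
  I (lin n0 n1 n2 n3) ->
  [/\ (2 %| n0)%Z, (2 %| n1)%Z, (2 %| n2)%Z & (2 %| n3)%Z].
Proof.
move=> oA oB oC ABC4; have eB := negPf oB.
have ns : ~ oi_bits true true true true.
  move=> Ib; have [m eABC] : exists m, A + B + C = m *+ 2.
    by exists ((A + B + C) %/ 2)%Z; move: oA oB oC; rewrite /oddz; lia.
  have om : oddz m by move: ABC4; rewrite eABC /oddz; lia.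
  have Is : I (lin (- (A + B)) 1 (- 1) 1) by apply/oi_bitsP; rewrite !oddzE oA eB.
  have /oi_bitsP := oi_shift eABC om Is; rewrite !oddzE oA eB => Iu.
  have {}Iu : I (lin A 0 1 0) by apply/oi_bitsP; rewrite oA.
  have [b eb] := oddzP B; rewrite eB add0r in eb.
  have eC : C = m *+ 2 - A - 2 * b by rewrite -eABC eb; ring.
  pose u := lin A 0 1 0.
  have : I ((A - b)%:~R * u - (A * (m - B))%:~R).
    apply: (oi_div HI Iu Iu).
    transitivity (A%:~R * u + z2 * u); first by rewrite /u /qlin; ring.
    by rewrite /u (z2M HQ) /qlin eC eb; ring.
  move=> J; have /(oi_int (p := 2) isT HI) : I (A * (m - B))%:~R.
    have := oiB HI (oiM HI (A - b)%:~R Iu) J; congr I; rewrite /u; ring.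
  by apply/negP; rewrite -/(oddz _) !oddzE oA om eB.
apply: bits_case => b0 b1 b2 b3 H; apply/negP => b_neq0.
have := oi_bitsM1 H; have := oi_bitsM2 H; have := oi_bitsM3 H.
rewrite oA oC eB => H3 H2 H1.
have H01 := oi_bitsD H H1; have H02 := oi_bitsD H H2; have H23 := oi_bitsD H2 H3.
have H0123 := oi_bitsD H01 H23.
by case: b0 b1 b2 b3 b_neq0 H H1 H2 H3 H01 H02 H23 H0123 => -[] [] [] //=.
Qed.

(** Modulo 2, F is (x^2 + x y + y^2)^2, and I would contain w = A + z1 + z2. Adding z1 w to half of
    w^2 then gives a nonzero element of the span of 1 and z2 modulo 2, which is the field F_4; so 1
    would lie in I. *)
Lemma maximal2_111 n0 n1 n2 n3 : oddz A -> oddz B -> oddz C ->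
  (4 %| A + B)%Z || (4 %| B + C)%Z ->
  I (lin n0 n1 n2 n3) ->
  [/\ (2 %| n0)%Z, (2 %| n1)%Z, (2 %| n2)%Z & (2 %| n3)%Z].
Proof.
move=> oA oB oC ABC4.
have nw : ~ oi_bits true true true false.
  move=> Ib; have := oi_bitsM1 Ib; rewrite oA oB oC /= => Iv.
  pose w := lin A 1 1 0.
  have Iw : I w by apply/oi_bitsP; rewrite oA.
  have [h eh] : exists h, 3 * A - B = 2 * h.
    by exists ((3 * A - B) %/ 2)%Z; move: oA oB; rewrite /oddz; lia.
  have [k ek] : exists k, A - C = 2 * k.
    by exists ((A - C) %/ 2)%Z; move: oA oC; rewrite /oddz; lia.
  have : I (lin (A * k) (A - B) h A).
    apply: (oi_div HI Iw Iw).
    transitivity (A%:~R * w + z1 * w + z2 * w); first by rewrite {1}/w /qlin; ring.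
    have eB : B = 3 * A - 2 * h by rewrite -eh; ring.
    have eC : C = A - 2 * k by rewrite -ek; ring.
    by rewrite /w (z1M HQ) (z2M HQ) /qlin eC eB; ring.
  move/oi_bitsP; rewrite !oddzE oA oB => /oi_bitsD/(_ Iv) /= J.
  (* If 4 divides A + B then h is even; otherwise 4 divides B + C and k is odd. *)
  have hk : ~~ oddz h || oddz k.
    by move: ABC4 oA oB oC; rewrite /oddz; lia.
  have := oi_bitsM2 J; rewrite oA oB oC => J2; have := oi_bitsD J J2.
  have nI1 := oi_bits1.
  by case: (oddz h) (oddz k) hk J J2 => -[].
apply: bits_case => b0 b1 b2 b3 H; apply/negP => b_neq0.
have := oi_bitsM1 H; have := oi_bitsM2 H.
rewrite oA oB oC => H2 H1; have H01 := oi_bitsD H H1.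
have G := oi_bitsD H01 H2; have := oi_bitsM1 G; rewrite oA oB oC => G1.
have G01 := oi_bitsD G G1.
by case: b0 b1 b2 b3 b_neq0 H H1 H2 H01 G G1 G01 => -[] [] [] //=.
Qed.
End MaximalAt2.

(** * The p-adic integers *)

Section PadicPrime.
Variables (p : nat) (pp : prime p).
Local Notation S := (padic_int p).
Implicit Types x y : S.

Let p_gt0 : (0 < p)%N := prime_gt0 pp.

Let expp_gt1 n : (1 < p ^ n.+1)%N.
Proof. by rewrite -(exp1n n.+1) ltn_exp2r ?prime_gt1. Qed.

Lemma padic_resD x y n : padic_res (x + y) n = x n + y n. Proof. by []. Qed.

Lemma padic_resM x y n : padic_res (x * y) n = x n * y n. Proof. by []. Qed.

Lemma padic_nat k n : padic_res (k%:R : S) n = k%:R.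
Proof. by elim: k => // k IHk; rewrite !mulrS padic_resD IHk. Qed.

Let resS x n : x n = (x n.+1 : nat)%:R.
Proof. by rewrite -[LHS](padic_resP x n). Qed.

Let val_natZ n k : (k%:R : 'Z_(p ^ n.+1)) = (k %% p ^ n.+1)%N :> nat.
Proof. by rewrite Zp_nat /= Zp_cast. Qed.

Let natZ_eq0 n k : (k%:R : 'Z_(p ^ n.+1)) = 0 -> (p ^ n.+1 %| k)%N.
Proof. by move/(congr1 val) => /=; rewrite val_natZ /dvdn => ->. Qed.

Let natZ0 n k : (p ^ n.+1 %| k)%N -> (k%:R : 'Z_(p ^ n.+1)) = 0.
Proof. by move=> d; apply: val_inj; rewrite /= val_natZ; apply/eqP. Qed.

Let res_modp x n : (x n %% p = x 0)%N.
Proof.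
elim: n => [|n IHn]; last first.
  by rewrite -IHn [x n]resS val_natZ modn_dvdm // dvdn_exp.
by rewrite modn_small // (leq_trans (ltn_ord (x 0%N))) // Zp_cast // expn1.
Qed.

Lemma padic_mulp_eq0 x : p%:R * x = 0 -> x = 0.
Proof.
move=> px; apply: padic_eqP => n.
have : padic_res (p%:R * x) n.+1 = 0 by rewrite px.
rewrite padic_resM padic_nat -[x n.+1]natr_Zp -natrM.
move=> /natZ_eq0; rewrite {1}expnS dvdn_pmul2l // => d.
by rewrite resS natZ0.
Qed.

Lemma padic_eqp x : x 0%N = 0 -> exists y, x = p%:R * y.
Proof.
(* Division by p loses one digit, so the quotient at index n is read off [x] at index n + 1. *)
move=> x0; pose y n : 'Z_(p ^ n.+1) := (x n.+1 %/ p)%:R.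
have yP n : padic_red (y n.+1) = y n.
  rewrite padic_red_nat /y; apply: val_inj; rewrite /= !val_natZ.
  by rewrite [x n.+1]resS val_natZ !modn_divl -expnSr modn_mod.
exists (PadicInt yP); apply: padic_eqP => n.
rewrite padic_resM padic_nat -natrM mulnC divnK -?resS //.
by rewrite /dvdn res_modp x0.
Qed.

Lemma padic_digit x : exists y, x = (x 0%N : nat)%:R + p%:R * y.
Proof.
have [|y e] := @padic_eqp (x - (x 0%N : nat)%:R).
  by apply: (canLR (addrK _)); rewrite add0r padic_nat natr_Zp.
by exists y; rewrite -e addrC subrK.
Qed.

Lemma padic_inv x : x 0%N != 0 -> exists y, x * y = 1.
Proof.
move=> x0; have xU n : x n \is a GRing.unit.
  rewrite -[x n]natr_Zp unitZpE // coprime_sym coprimeXr //.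
  by rewrite coprime_sym prime_coprime // /dvdn res_modp.
have yP n : padic_red (x n.+1)^-1 = (x n)^-1.
  have e : padic_red (x n.+1 * (x n.+1)^-1) = 1 by rewrite (divrr (xU n.+1)); exact: padic_red1.
  by apply: (mulrI (xU n)); rewrite (divrr (xU n)) -e padic_redM padic_resP.
by exists (PadicInt yP); apply: padic_eqP => n; exact: divrr (xU n).
Qed.

Lemma padic_neq1p y : p%:R * y != 1 :> S.
Proof.
apply/eqP => /(congr1 (fun z : S => padic_res z 0%N)).
by rewrite padic_resM padic_nat natZ0 ?expn1.
Qed.

(** The values are taken in 'F_p rather than 'Z_(p ^ 1), so that linear algebra over a field
    applies. *)
Definition padic_residue x : 'F_p := (x 0%N : nat)%:R.

Let natFp_mod k : (k %% p)%:R = k%:R :> 'F_p.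
Proof.
have pF : p%:R = 0 :> 'F_p by have /andP[_ /eqP] := pchar_Fp pp.
by rewrite [in RHS](divn_eq k p) natrD natrM pF mulr0 add0r.
Qed.

Let natZ_Fp k : ((k%:R : 'Z_(p ^ 1)) : nat)%:R = k%:R :> 'F_p.
Proof. by rewrite val_natZ expn1 natFp_mod. Qed.

Lemma padic_residue_additive : zmod_morphism padic_residue.
Proof.
have resD : {morph padic_residue : x y / x + y}.
  move=> x y; rewrite /padic_residue -natrD padic_resD.
  by rewrite -[x 0%N in LHS]natr_Zp -[y 0%N in LHS]natr_Zp -natrD natZ_Fp.
by move=> x y; apply/eqP; rewrite eq_sym subr_eq -resD subrK.
Qed.

Lemma padic_residue_multiplicative : monoid_morphism padic_residue.
Proof.
split=> [|x y]; rewrite /padic_residue.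
  exact: (natZ_Fp 1).
rewrite -natrM padic_resM.
by rewrite -[x 0%N in LHS]natr_Zp -[y 0%N in LHS]natr_Zp -natrM natZ_Fp.
Qed.

Lemma padic_residue_eq0 x : padic_residue x = 0 -> x 0%N = 0.
Proof.
rewrite /padic_residue => /(congr1 val); rewrite /= val_Fp_nat // => x0.
by apply: val_inj; rewrite /= -[LHS](res_modp x 0).
Qed.
End PadicPrime.

(** * Overrings of a quartic ring *)

Lemma linear_fun0 (R : comNzRingType) (U V : lmodType R) (f : U -> V) :
  linear f -> f 0 = 0.
Proof. by move=> f_lin; have := f_lin (-1) 0 0; rewrite scaler0 addr0 scaleN1r addNr. Qed.

Lemma linear_mx (R : comNzRingType) m n (f : 'rV[R]_m -> 'rV[R]_n) :
  linear f -> exists M : 'M_(m, n), forall v, f v = v *m M.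
Proof.
move=> f_lin; pose mixin := GRing.isLinear.Build R _ _ _ f f_lin.
pose g : {linear 'rV_m -> 'rV_n} := HB.pack f mixin.
by exists (lin1_mx g) => v; rewrite mul_rV_lin1.
Qed.

Section FreeAlgebra.
Variables (R : comNzRingType) (Q : comAlgType R) (n : nat).
Hypothesis freeQ : Vector.axiom n.+1 Q.

(** Cayley-Hamilton for the matrix of multiplication by y. *)
Lemma free_alg_integral (y : Q) :
  exists c : 'I_n.+1 -> R, y ^+ n.+1 = \sum_(i < n.+1) c i *: y ^+ i.
Proof.
case: freeQ => v v_lin [r vK rK].
have rlin : linear r by move=> a x z; apply: (can_inj vK); rewrite v_lin !rK.
have [M M_P] : exists M : 'M_n.+1, forall x, v (y * r x) = x *m M.
  apply: linear_mx => a x z.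
  by rewrite rlin mulrDr -scalerAr v_lin.
have vX k x : v (y ^+ k * x) = v x *m M ^+ k.
  elim: k x => [|k IHk] x; first by rewrite !expr0 mul1r mulmx1.
  by rewrite exprS -mulrA -{1}[_ * x]vK M_P IHk exprSr mulmxA.
have vX1 k : v (y ^+ k) = v 1 *m M ^+ k by rewrite -vX mulr1.
exists (fun i => - (char_poly M)`_i); apply: (can_inj vK).
have v0 : v 0 = 0 := linear_fun0 v_lin.
have vD : {morph v : a b / a + b} by move=> a b; rewrite -[a]scale1r v_lin !scale1r.
have vZ a x : v (a *: x) = a *: v x by rewrite -[_ *: x]addr0 v_lin v0 addr0.
rewrite (big_morph v vD v0) vX1; under eq_bigr do rewrite vZ vX1 scaleNr.
apply/eqP; rewrite sumrN -addr_eq0; apply/eqP.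
have CH : \sum_(i < n.+2) (char_poly M)`_i *: M ^+ i = 0.
  transitivity (horner_mx M (char_poly M)); last exact: Cayley_Hamilton.
  rewrite -[in RHS](coefK (char_poly M)) size_char_poly.
  rewrite poly_def [RHS]linear_sum; apply: eq_bigr => i _.
  by rewrite [RHS]horner_mxZ rmorphXn /= horner_mx_X.
under eq_bigr do rewrite scalemxAr.
rewrite -mulmx_sumr -mulmxDr addrC; move: CH; rewrite big_ord_recr /=.
have /monicP := char_poly_monic M; rewrite lead_coefE size_char_poly /= => ->.
by rewrite scale1r => ->; rewrite mulmx0.
Qed.
End FreeAlgebra.

(** * A criterion for maximality over Z_p *)

Section MaximalCriterion.
Variables (p : nat) (pp : prime p).
Local Notation S := (padic_int p).

HB.instance Definition _ :=
  GRing.isZmodMorphism.Build S 'F_p (@padic_residue p) (padic_residue_additive pp).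
HB.instance Definition _ :=
  GRing.isMonoidMorphism.Build S 'F_p (@padic_residue p) (padic_residue_multiplicative pp).

Let scale_p (Q : comAlgType S) (x : Q) : p%:R *: x = p%:~R * x.
Proof. by rewrite scaler_nat -pmulrn mulr_natl. Qed.

Let mulp_eq0 (Q : comAlgType S) (x : Q) :
  is_quartic_ring Q -> p%:~R * x = 0 -> x = 0.
Proof.
case=> -[v v_lin [r vK rK]].
have v0 : v 0 = 0 := linear_fun0 v_lin.
rewrite -scale_p => px; apply: (can_inj vK); rewrite v0; apply/rowP => i.
have := v_lin p%:R x 0; rewrite v0 !addr0 px v0 => /rowP/(_ i).
by rewrite !mxE => /esym/(padic_mulp_eq0 pp).
Qed.

Let mulp_neq1 (Q : comAlgType S) (x : Q) : is_quartic_ring Q -> p%:~R * x <> 1.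
Proof.
case=> -[v v_lin [r vK rK]] px.
have v0 : v 0 = 0 := linear_fun0 v_lin.
pose e := r (delta_mx 0 0).
have := v_lin p%:R (x * e) 0; rewrite v0 !addr0 scale_p mulrA px mul1r rK.
by move/rowP/(_ 0); rewrite !mxE /= => /esym/eqP; apply/negP/padic_neq1p.
Qed.

(** Let N be the matrix of an injective f : Q -> Q'. If det N is a unit, the adjugate inverts f.
    Otherwise a nonzero row killed by N modulo p lifts to an element of the preimage of p Q' outside
    p Q. *)
Lemma maximal_of_overring_ideal (Q : comAlgType S) : is_quartic_ring Q ->
  (forall I, overring_ideal p I -> forall a : Q, I a -> exists b, a = p%:~R * b) ->
  maximal_quartic_ring Q.
Proof.
move=> quarticQ Q_ideals; split=> // Q' f quarticQ' f_inj.
pose I a := exists y, f a = p%:~R * y.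
have HI : overring_ideal p I.
  split.
  - by move=> a b [x ex] [y ey]; exists (x + y); rewrite rmorphD /= ex ey mulrDr.
  - by move=> q a [x ex]; exists (f q * x); rewrite rmorphM /= ex; ring.
  - by exists 1; rewrite mulr1 rmorph_int.
  - by case=> y; rewrite rmorph1 => /esym; apply: mulp_neq1.
  - move=> a [y ey]; have [free] := quarticQ'.
    have [c ec] := free_alg_integral free y.
    (* With f a = p y, multiplying the relation for y^4 by p^4 turns each term c_i y^i into c_i p^(4
       - i) times the image of a^i; one factor p is taken out. *)
    exists (\sum_(i < 4) p%:~R ^+ (3 - i) * (c i *: a ^+ i)).
    apply: f_inj; rewrite rmorphXn /= ey exprMn ec rmorphM rmorph_int /= linear_sum.
    rewrite !mulr_sumr; apply: eq_bigr => i _.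
    rewrite rmorphM rmorphXn rmorph_int /= linearZ /= rmorphXn /= ey exprMn.
    rewrite -!scalerAr !mulrA; congr (_ *: (_ * _)).
    by rewrite -exprS -exprD; congr (_ ^+ _); have := ltn_ord i; lia.
  - move=> a b c [x ex] [y ey] ab; exists (x * y).
    apply/eqP; rewrite -subr_eq0; apply/eqP; apply: mulp_eq0 => //.
    have := congr1 f ab; rewrite !rmorphM rmorph_int /= ex ey => h.
    by rewrite mulrBr -h; ring.
have {}Q_ideals := Q_ideals I HI.
have [[v v_lin [r vK rK]]] := quarticQ; have [[v' v'_lin [r' v'K r'K]]] := quarticQ'.
have rlin : linear r by move=> a x z; apply: (can_inj vK); rewrite v_lin !rK.
have [N NP] : exists N : 'M_4, forall x, v' (f (r x)) = x *m N.
  by apply: linear_mx => a x z; rewrite rlin linearP v'_lin.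
have [det0|/(padic_inv pp)[d ed]] := eqVneq (padic_res (\det N) 0) 0; last first.
  move=> y; exists (r (d *: (v' y *m \adj N))); apply: (can_inj v'K).
  rewrite NP -scalemxAl -mulmxA mul_adj_mx mul_mx_scalar scalerA.
  by rewrite mulrC ed scale1r.
have : \det (map_mx (@padic_residue p) N) == 0.
  by rewrite det_map_mx /= /padic_residue det0.
case/det0P => w w_neq0 wN.
pose x : 'rV[S]_4 := \row_i (w 0 i : nat)%:R.
have xw : map_mx (@padic_residue p) x = w.
  by apply/rowP => i; rewrite !mxE rmorph_nat natr_Zp.
have Ix : I (r x).
  have /fin_all_exists[y yP] : forall i, exists y, (x *m N) 0 i = p%:R * y.
    move=> i; apply: (padic_eqp pp); apply: (padic_residue_eq0 pp).
    have /rowP/(_ i) := wN; rewrite -xw -map_mxM.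
    by rewrite [X in X = _]mxE [X in _ = X]mxE.
  exists (r' (\row_i y i)); apply: (can_inj v'K).
  have v'0 : v' 0 = 0 := linear_fun0 v'_lin.
  rewrite NP -scale_p -[_ *: _]addr0 v'_lin v'0 addr0 r'K.
  by apply/rowP => i; rewrite yP !mxE.
have [b eb] := Q_ideals _ Ix; case/eqP: w_neq0.
have v0 : v 0 = 0 := linear_fun0 v_lin.
have ex : x = p%:R *: v b by rewrite -[x]rK eb -scale_p -[_ *: b]addr0 v_lin v0 addr0.
rewrite -xw ex; apply/rowP => i; rewrite !mxE rmorphM /= rmorph_nat.
by have /andP[_ /eqP->] := pchar_Fp pp; rewrite mul0r.
Qed.
End MaximalCriterion.

(* A submodule J containing p Q and such that J J is contained in p J, given by
   a basis; then (1/p) J is an overring of Q. *)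
Record dilation (R : comNzRingType) (Q : comAlgType R) (p : R) := Dilation {
  dil_basis : 'I_4 -> Q;
  dil_val (u : 'rV[R]_4) : Q := \sum_(i < 4) u 0 i *: dil_basis i;
  dil_inj : injective dil_val;
  dil_closed : forall i j, exists w,
    p *: dil_val w = dil_basis i * dil_basis j;
  dil_p : forall q, exists u, dil_val u = p *: q;
  dil_reg : forall q : Q, p *: q = 0 -> q = 0
}.

(** * The overring attached to a lattice *)

Section Dilation.
Variables (R : comNzRingType) (Q : comAlgType R) (p : R) (J : dilation Q p).
Local Notation val := (dil_val J).

(** A vector u stands for (1/p) [val u]; indexing the type by J lets its product depend on J. *)
Definition dil_ring (J : dilation Q p) : Type := 'rV[R]_4.
Local Notation T := (dil_ring J).

HB.instance Definition _ := GRing.Lmodule.copy T 'rV[R]_4.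

Lemma dil_val_linear : linear (val : T -> Q).
Proof.
move=> a u v; rewrite /dil_val scaler_sumr -big_split /=.
by apply: eq_bigr => i _; rewrite !mxE scalerDl scalerA.
Qed.
HB.instance Definition _ := GRing.isLinear.Build R T Q _ (val : T -> Q) dil_val_linear.

Let valD (u v : T) : val (u + v) = val u + val v.
Proof. exact: (raddfD (val : {linear T -> Q})). Qed.

Let valZ a (u : T) : val (a *: u) = a *: val u.
Proof. exact: (linearZ_LR (val : {linear T -> Q})). Qed.

Let val_sum (f : 'I_4 -> T) : val (\sum_i f i) = \sum_i val (f i).
Proof. exact: (raddf_sum (val : {linear T -> Q})). Qed.

Let dil_mul_subproof (u v : T) : exists w : T, p *: val w = val u * val v.
Proof.
have /choice[w wP] : forall ij : 'I_4 * 'I_4, exists w,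
    p *: val w = dil_basis J ij.1 * dil_basis J ij.2.
  by move=> ij; apply: dil_closed.
exists (\sum_i \sum_j (u 0 i * v 0 j) *: (w (i, j) : T)).
rewrite val_sum scaler_sumr [in RHS]/dil_val mulr_suml.
apply: eq_bigr => i _; rewrite val_sum scaler_sumr mulr_sumr.
apply: eq_bigr => j _; rewrite valZ scalerA mulrC -scalerA wP /=.
by rewrite -scalerAl -scalerAr scalerA.
Qed.

Definition dil_mul (u v : T) : T := projT1 (cid (dil_mul_subproof u v)).

Lemma dil_mulE u v : p *: val (dil_mul u v) = val u * val v.
Proof. exact: (projT2 (cid (dil_mul_subproof u v))). Qed.

Definition dil_map (q : Q) : T := projT1 (cid (dil_p J q)).

Lemma dil_mapE q : val (dil_map q) = p *: q.
Proof. exact: (projT2 (cid (dil_p J q))). Qed.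

Let pval_inj (u v : T) : p *: val u = p *: val v -> u = v.
Proof.
move=> e; apply: (dil_inj (d := J)); apply/eqP; rewrite -subr_eq0; apply/eqP.
by apply: (dil_reg J); rewrite scalerBr e subrr.
Qed.

Fact dil_mulC : commutative dil_mul.
Proof. by move=> u v; apply: pval_inj; rewrite !dil_mulE mulrC. Qed.

Fact dil_mulA : associative dil_mul.
Proof.
move=> u v w; apply: pval_inj; rewrite !dil_mulE.
apply/eqP; rewrite -subr_eq0; apply/eqP; apply: (dil_reg J).
by rewrite scalerBr scalerAr scalerAl !dil_mulE mulrA subrr.
Qed.

Fact dil_mul1 : left_id (dil_map 1) dil_mul.
Proof.
by move=> u; apply: pval_inj; rewrite dil_mulE dil_mapE -scalerAl mul1r.
Qed.

Fact dil_mulD : left_distributive dil_mul +%R.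
Proof.
move=> u v w; apply: pval_inj.
by rewrite valD scalerDr !dil_mulE valD mulrDl.
Qed.

Fact dil_one_neq0 : dil_map 1 != 0.
Proof.
apply/eqP => e; have := dil_mapE 1; rewrite e (raddf0 (val : {linear T -> Q})).
by move/esym/(dil_reg J)/eqP; rewrite oner_eq0.
Qed.

HB.instance Definition _ := GRing.Zmodule_isComNzRing.Build T
  dil_mulA dil_mulC dil_mul1 dil_mulD dil_one_neq0.

Fact dil_scaleAl (a : R) (u v : T) : a *: (u * v) = (a *: u) * v.
Proof.
apply: pval_inj; rewrite valZ scalerA mulrC -scalerA.
by rewrite [LHS](congr1 _ (dil_mulE u v)) [RHS]dil_mulE valZ scalerAl.
Qed.

HB.instance Definition _ := GRing.Lmodule_isLalgebra.Build R T dil_scaleAl.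
HB.instance Definition _ := GRing.Lalgebra_isComAlgebra.Build R T.

Fact dil_map_linear : linear dil_map.
Proof.
move=> a x y; apply: (dil_inj (d := J)).
by rewrite dil_mapE valD valZ !dil_mapE scalerDr !scalerA mulrC.
Qed.
HB.instance Definition _ := GRing.isLinear.Build R Q T _ dil_map dil_map_linear.

Fact dil_map_multiplicative : monoid_morphism dil_map.
Proof.
split=> // x y; apply: pval_inj.
by rewrite dil_mapE [RHS]dil_mulE !dil_mapE -scalerAl -scalerAr.
Qed.
HB.instance Definition _ := GRing.isMonoidMorphism.Build Q T dil_map dil_map_multiplicative.

(** The i-th basis vector stands for J_i / p, which lies in the image of Q only if J_i is a multiple
    of p. *)
Lemma not_maximal_dilation (i : 'I_4) :
  (forall q, dil_basis J i <> p *: q) -> ~ maximal_quartic_ring Q.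
Proof.
move=> Ji [_ Qmax]; pose f : {lrmorphism Q -> T} := dil_map.
have quarticT : is_quartic_ring T.
  by constructor; exists (fun u : T => u : 'rV_4) => //; exists id.
have f_inj : injective f.
  move=> x y e; apply/eqP; rewrite -subr_eq0; apply/eqP; apply: (dil_reg J).
  by rewrite scalerBr -!dil_mapE [dil_map x]e subrr.
have [q] := Qmax T f quarticT f_inj (delta_mx 0 i : 'rV_4).
move/(congr1 val); rewrite dil_mapE => e; apply: (Ji q); rewrite -e.
rewrite /dil_val (bigD1 i) //= mxE !eqxx scale1r big1 ?addr0 // => j ji.
by rewrite mxE eqxx (negPf ji) scale0r.
Qed.
End Dilation.

(** * The ring of an even binary quartic form *)

Lemma ord4P (P : 'I_4 -> Prop) : P 0 -> P 1 -> P 2 -> P 3 -> forall i, P i.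
Proof.
move=> P0 P1 P2 P3 [[|[|[|[|//]]]] hi].
- by rewrite (_ : Ordinal hi = 0) //; apply: val_inj.
- by rewrite (_ : Ordinal hi = 1) //; apply: val_inj.
- by rewrite (_ : Ordinal hi = 2) //; apply: val_inj.
- by rewrite (_ : Ordinal hi = 3) //; apply: val_inj.
Qed.

Lemma sum4 (V : nmodType) (f : 'I_4 -> V) : \sum_i f i = f 0 + f 1 + f 2 + f 3.
Proof.
rewrite !big_ord_recl big_ord0 addr0 !addrA.
by congr (f _ + f _ + f _ + f _); apply: val_inj.
Qed.

Lemma scale_comb4 (R : comNzRingType) (V : lmodType R) (p a b c d : R) (x y z t : V) :
  p *: (a *: x + b *: y + c *: z + d *: t) =
  a *: (p *: x) + (b *: (p *: y) + (c *: (p *: z) + (d *: (p *: t) + 0))).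
Proof. by rewrite !scalerDr !scalerA !(mulrC p) addr0 !addrA. Qed.

Lemma qcoefE (R : comNzRingType) (F : binary_quartic R) c0 c1 c2 c3 :
  qcoef F c0 c1 c2 c3 =
  c0 *: qbasis F 0 + c1 *: qbasis F 1 + c2 *: qbasis F 2 + c3 *: qbasis F 3.
Proof. by apply/rowP; apply: ord4P; rewrite !mxE /=; ring. Qed.

Lemma qcoef_inj (R : comNzRingType) (F : binary_quartic R) a0 a1 a2 a3 b0 b1 b2 b3 :
  qcoef F a0 a1 a2 a3 = qcoef F b0 b1 b2 b3 -> [/\ a0 = b0, a1 = b1, a2 = b2 & a3 = b3].
Proof.
move=> /rowP e; split.
- by have := e 0; rewrite !mxE.
- by have := e 1; rewrite !mxE.
- by have := e 2; rewrite !mxE.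
- by have := e 3; rewrite !mxE.
Qed.

Lemma qcoef_comb (R : comNzRingType) (F : binary_quartic R)
    (a b c d n d1 d2 d3 e20 e21 e30 e31 e32 : R) :
  a *: qcoef F n 0 0 0 + b *: qcoef F 0 d1 0 0 + c *: qcoef F e20 e21 d2 0
    + d *: qcoef F e30 e31 e32 d3 =
  qcoef F (a * n + c * e20 + d * e30) (b * d1 + c * e21 + d * e31)
    (c * d2 + d * e32) (d * d3).
Proof. by apply/rowP; apply: ord4P; rewrite !mxE /=; ring. Qed.

Lemma qcoef_lin (R : comNzRingType) (F : binary_quartic R) (n0 n1 n2 n3 : int) :
  qcoef F n0%:~R n1%:~R n2%:~R n3%:~R =
  qlin (qbasis F 1) (qbasis F 2) (qbasis F 3) n0 n1 n2 n3.
Proof. by rewrite qcoefE /qlin !scaler_int !mulrzl. Qed.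

Section QRing.
Variables (p : nat) (pp : prime p) (A B C : int).
Local Notation S := (padic_int p).
Local Notation F := (map_bq intr (BinaryQuartic A 0 B 0 C) : binary_quartic S).
Local Notation z1 := (qbasis F 1).
Local Notation z2 := (qbasis F 2).
Local Notation z3 := (qbasis F 3).
Local Notation lin := (qlin z1 z2 z3).

Lemma scale_p (q : qring F) : p%:~R * q = p%:R *: q.
Proof. by rewrite scaler_nat -pmulrn mulr_natl. Qed.

(** The first p-adic digits of the coordinates give [qgen]; [qfree] holds because p is not
    invertible in Z_p. *)
Lemma qring_qpres : qpres p A B C z1 z2 z3.
Proof.
have tab (i j : 'I_4) n0 n1 n2 n3 :
  qtable F i j = qcoef F n0%:~R n1%:~R n2%:~R n3%:~R ->
  qbasis F i * qbasis F j = lin n0 n1 n2 n3.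
  by rewrite qmul_basis qcoef_lin.
split.
- rewrite (tab 1 1 0 0 A 0); last by rewrite /= oppr0.
  by rewrite /qlin; ring.
- rewrite (tab 1 2 0 (- B) 0 A); last by rewrite /= mulrNz.
  by rewrite /qlin; ring.
- rewrite (tab 1 3 (- (A * C)) 0 0 0); last by rewrite /= mulrNz intrM oppr0.
  by rewrite /qlin; ring.
- rewrite (tab 2 2 (- (A * C)) 0 (- B) 0); last by rewrite /= !mulrNz intrM oppr0.
  by rewrite /qlin; ring.
- rewrite (tab 2 3 0 (- C) 0 0); last by rewrite /= !mulrNz !oppr0 mul0r oppr0.
  by rewrite /qlin; ring.
- rewrite (tab 3 3 (- (B * C)) 0 (- C) 0); last by rewrite /= !mulrNz intrM oppr0.
  by rewrite /qlin; ring.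
- move=> q.
  have /fin_all_exists[y yP] : forall i, exists y,
      q 0 i = (padic_res (q 0 i) 0 : nat)%:R + p%:R * y.
    by move=> i; apply: padic_digit.
  pose n i : nat := padic_res (q 0 i) 0.
  exists (n 0), (n 1), (n 2), (n 3), (\row_i y i).
  transitivity (lin (n 0) (n 1) (n 2) (n 3) + p%:R *: (\row_i y i : qring F)).
    rewrite -qcoef_lin; apply/rowP; apply: ord4P; rewrite !mxE /= -pmulrn; exact: yP.
  by rewrite scale_p.
- move=> n0 n1 n2 n3 r; rewrite -[LHS]/(lin n0 n1 n2 n3) -qcoef_lin scale_p => e.
  have pdvd (n : int) (x : S) : n%:~R = p%:R * x -> (p %| n)%Z.
    move=> nx; rewrite -[(p %| n)%Z]negbK -coprimez_prime //; apply/negP.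
    case/coprimez_inv=> u [v uv]; have /eqP[] := padic_neq1p pp (x * u%:~R - v%:~R).
    rewrite mulrBr mulrA -nx -intrM uv; ring.
  split.
  - by apply: (@pdvd _ (r 0 0)); move/rowP/(_ 0): e; rewrite !mxE.
  - by apply: (@pdvd _ (r 0 1)); move/rowP/(_ 1): e; rewrite !mxE.
  - by apply: (@pdvd _ (r 0 2)); move/rowP/(_ 2): e; rewrite !mxE.
  - by apply: (@pdvd _ (r 0 3)); move/rowP/(_ 3): e; rewrite !mxE.
Qed.


Lemma maximal_qring :
  (forall I, overring_ideal p I -> forall n0 n1 n2 n3, I (lin n0 n1 n2 n3) ->
    [/\ (p %| n0)%Z, (p %| n1)%Z, (p %| n2)%Z & (p %| n3)%Z]) ->
  maximal_quartic_ring (qring F).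
Proof.
move=> H; apply: (maximal_of_overring_ideal pp (@qring_quartic _ F)) => I HI a Ia.
have [n0 [n1 [n2 [n3 [r er]]]]] := qgen qring_qpres a.
have := H I HI n0 n1 n2 n3 (oi_cong HI Ia er).
case=> /dvdzP[m0 e0] /dvdzP[m1 e1] /dvdzP[m2 e2] /dvdzP[m3 e3].
by exists (lin m0 m1 m2 m3 + r); rewrite er e0 e1 e2 e3 /qlin; ring.
Qed.

Definition int_span (j1 j2 j3 q : qring F) : Prop :=
  exists a0 a1 a2 a3 : int,
    q = a0%:~R * p%:~R + a1%:~R * j1 + a2%:~R * j2 + a3%:~R * j3.

Lemma int_spanI (j1 j2 j3 q : qring F) (a0 a1 a2 a3 : int) :
  q = a0%:~R * p%:~R + a1%:~R * j1 + a2%:~R * j2 + a3%:~R * j3 ->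
  int_span j1 j2 j3 q.
Proof. by move=> ->; exists a0, a1, a2, a3. Qed.

Lemma int_span_mulpI (j1 j2 j3 q : qring F) (a0 a1 a2 a3 : int) :
  q = p%:~R * (a0%:~R * p%:~R + a1%:~R * j1 + a2%:~R * j2 + a3%:~R * j3) ->
  exists2 r, int_span j1 j2 j3 r & q = p%:~R * r.
Proof. by move=> ->; eexists; [apply: int_spanI|]. Qed.

(** The lattice J has the triangular basis p, j1, j2, j3; its diagonal entries 1 or p are regular,
    and an entry 1 makes J larger than p Q. That J contains p Q and that J J lies in p J are left as
    identities with integer coefficients. *)
Lemma not_maximal_qring (d1 d2 d3 e20 e21 e30 e31 e32 : int)
    (j1 := lin 0 d1 0 0) (j2 := lin e20 e21 d2 0) (j3 := lin e30 e31 e32 d3) :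
    d1 \in [:: 1; p%:Z] -> d2 \in [:: 1; p%:Z] -> d3 \in [:: 1; p%:Z] ->
    [|| d1 == 1, d2 == 1 | d3 == 1] ->
    int_span j1 j2 j3 (p%:~R * z1) -> int_span j1 j2 j3 (p%:~R * z2) ->
    int_span j1 j2 j3 (p%:~R * z3) ->
    (exists2 q, int_span j1 j2 j3 q & j1 * j1 = p%:~R * q) ->
    (exists2 q, int_span j1 j2 j3 q & j1 * j2 = p%:~R * q) ->
    (exists2 q, int_span j1 j2 j3 q & j1 * j3 = p%:~R * q) ->
    (exists2 q, int_span j1 j2 j3 q & j2 * j2 = p%:~R * q) ->
    (exists2 q, int_span j1 j2 j3 q & j2 * j3 = p%:~R * q) ->
    (exists2 q, int_span j1 j2 j3 q & j3 * j3 = p%:~R * q) ->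
  ~ maximal_quartic_ring (qring F).
Proof.
move=> d1P d2P d3P d_eq1 s1 s2 s3 p11 p12 p13 p22 p23 p33.
pose J (i : 'I_4) : qring F := [:: p%:~R; j1; j2; j3]`_i.
pose v (u : 'rV[S]_4) : qring F := \sum_(i < 4) u 0 i *: J i.
have vE u : v u = u 0 0 *: p%:~R + u 0 1 *: j1 + u 0 2 *: j2 + u 0 3 *: j3.
  by rewrite /v sum4.
have spanv q : int_span j1 j2 j3 q -> exists u, v u = q.
  case=> a0 [a1 [a2 [a3 ->]]].
  exists (\row_(i < 4) ([:: a0; a1; a2; a3]`_i)%:~R); rewrite vE !mxE /=.
  by rewrite !scaler_int !mulrzl.
have reg (x y : S) d : d \in [:: 1; p%:Z] -> x * d%:~R = y * d%:~R -> x = y.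
  rewrite !inE => /orP[]/eqP->; first by rewrite !mulr1.
  move/eqP; rewrite -subr_eq0 -mulrBl mulrC => /eqP/(padic_mulp_eq0 pp)/eqP.
  by rewrite subr_eq0 => /eqP.
have v_inj : injective v.
  move=> u w; rewrite !vE /j1 /j2 /j3 -!qcoef_lin.
  have -> : (p%:~R : qring F) = qcoef F (p%:Z)%:~R 0%:~R 0%:~R 0%:~R.
    by rewrite qcoef_lin /qlin; ring.
  rewrite -[0%:~R]/0 !qcoef_comb => /qcoef_inj[e0 e1 e2 /(reg _ _ _ d3P) e3].
  move: e2; rewrite e3 => /addIr/(reg _ _ _ d2P) e2.
  move: e1; rewrite e3 e2 => /addIr/addIr/(reg _ _ _ d1P) e1.
  move: e0; rewrite e3 e2 => /addIr/addIr/reg e0.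
  by apply/rowP; apply: ord4P => //; apply: e0; rewrite !inE eqxx orbT.
have v_lin : linear v.
  move=> a u w; rewrite /v scaler_sumr -big_split /=.
  by apply: eq_bigr => i _; rewrite !mxE scalerDl scalerA.
have prod j k : (exists2 q, int_span j1 j2 j3 q & j * k = p%:~R * q) ->
    exists w, p%:R *: v w = j * k.
  by case=> q /spanv[w <-] ->; exists w; rewrite scale_p.
have prodC j k : (exists2 q, int_span j1 j2 j3 q & j * k = p%:~R * q) ->
    (exists2 q, int_span j1 j2 j3 q & k * j = p%:~R * q) by rewrite mulrC.
have s00 : int_span j1 j2 j3 p%:~R by exists 1, 0, 0, 0; ring.
have v_closed i k : exists w, p%:R *: v w = J i * J k.
  apply: prod; have p0 j : int_span j1 j2 j3 j ->
    exists2 q, int_span j1 j2 j3 q & p%:~R * j = p%:~R * q by exists j.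
  have s01 : int_span j1 j2 j3 j1 by exists 0, 1, 0, 0; ring.
  have s02 : int_span j1 j2 j3 j2 by exists 0, 0, 1, 0; ring.
  have s03 : int_span j1 j2 j3 j3 by exists 0, 0, 0, 1; ring.
  have J_case l : [\/ J l = p%:~R, J l = j1, J l = j2 | J l = j3].
    by move: l; apply: ord4P; [apply: Or41|apply: Or42|apply: Or43|apply: Or44].
  case: (J_case i) => ->; case: (J_case k) => ->.
  - exact: (p0 _ s00).
  - exact: (p0 _ s01).
  - exact: (p0 _ s02).
  - exact: (p0 _ s03).
  - exact: (prodC _ _ (p0 _ s01)).
  - exact: p11.
  - exact: p12.
  - exact: p13.
  - exact: (prodC _ _ (p0 _ s02)).
  - exact: (prodC _ _ p12).
  - exact: p22.
  - exact: p23.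
  - exact: (prodC _ _ (p0 _ s03)).
  - exact: (prodC _ _ p13).
  - exact: (prodC _ _ p23).
  - exact: p33.
have v_p q : exists u, v u = p%:R *: q.
  pose K x := exists u, v u = x.
  have K0 : K 0.
    by exists 0; apply: linear_fun0 v_lin.
  have KD a x y : K x -> K y -> K (a *: x + y).
    by move=> [u <-] [w <-]; exists (a *: u + w); rewrite v_lin.
  have -> : p%:R *: q = q 0 0 *: p%:~R + (q 0 1 *: (p%:~R * z1)
      + (q 0 2 *: (p%:~R * z2) + (q 0 3 *: (p%:~R * z3) + 0))).
    rewrite {1}(qbasisE q) sum4 scale_comb4 -!scale_p.
    by rewrite -[p%:~R * qbasis F 0]/(p%:~R * 1) mulr1.
  have [k1 [k2 k3]] := (spanv _ s1, (spanv _ s2, spanv _ s3)).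
  have k0 := spanv _ s00.
  exact/(KD _ _ _ k0)/(KD _ _ _ k1)/(KD _ _ _ k2)/(KD _ _ _ k3).
have dreg (q : qring F) : p%:R *: q = 0 -> q = 0.
  move=> pq; apply/rowP => i; move/rowP/(_ i): pq; rewrite !mxE.
  exact: padic_mulp_eq0.
pose D := @Dilation S (qring F) p%:R J v_inj v_closed v_p dreg.
have new j c0 c1 c2 c3 (l : 'I_4) (q : qring F) : qcoef F c0 c1 c2 c3 0 l = 1 ->
    j = qcoef F c0 c1 c2 c3 -> j <> p%:R *: q.
  move=> cl -> /rowP/(_ l); rewrite cl mxE => /esym/eqP.
  exact/negP/padic_neq1p.
case/or3P: d_eq1 => /eqP d_eq1.
- apply: (@not_maximal_dilation _ _ _ D 1) => q.
  by apply: (new _ 0%:~R 1%:~R 0%:~R 0%:~R 1); rewrite ?mxE // qcoef_lin /= /J /= /j1 d_eq1.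
- apply: (@not_maximal_dilation _ _ _ D 2) => q.
  by apply: (new _ e20%:~R e21%:~R 1%:~R 0%:~R 2); rewrite ?mxE // qcoef_lin /= /J /= /j2 d_eq1.
- apply: (@not_maximal_dilation _ _ _ D 3) => q.
  by apply: (new _ e30%:~R e31%:~R e32%:~R 1%:~R 3); rewrite ?mxE // qcoef_lin /= /J /= /j3 d_eq1.
Qed.
End QRing.

Arguments int_spanI {p A B C j1 j2 j3 q} a0 a1 a2 a3.
Arguments int_span_mulpI {p A B C j1 j2 j3 q} a0 a1 a2 a3.

(** The universal properties give h from T to Q_F over Z_p and k back, with k (h x) = x. So h is
    injective, and composition with h turns an overring of Q_F over Z_p into one of T. *)
Lemma maximal_atE (p : nat) (F : binary_quartic int) :
  maximal_at p (qring F) <->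
  maximal_quartic_ring (qring (map_bq intr F : binary_quartic (padic_int p))).
Proof.
pose FS : binary_quartic (padic_int p) := map_bq intr F.
split=> [[T [i [tensT [quarticT Tmax]]]]|maxF]; last first.
  exists (qring FS), (@qring_map (padic_int p) F : {rmorphism qring F -> qring FS}).
  by split=> //; apply: qring_tensorZ.
split=> [|Q' f quarticQ' f_inj y]; first exact: qring_quartic.
pose m : {rmorphism qring F -> qring FS} := @qring_map (padic_int p) F.
have [[h hi] _] := tensT (qring FS) m.
have [[k ki] _] := qring_tensorZ i.
have [_ T_uniq] := tensT T i.
have kh x : k (h x) = x.
  apply: (T_uniq (k \o h : {lrmorphism T -> T}) (idfun : {lrmorphism T -> T})) => u.
  by rewrite /= hi ki.
have fh_inj : injective (f \o h).
  by move=> u v /f_inj e; rewrite -[u]kh e kh.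
have [x ->] := Tmax Q' (f \o h : {lrmorphism T -> Q'}) quarticQ' fh_inj y.
by exists (h x).
Qed.

(** * Overrings when a congruence fails *)

Section NotMaximal.
Variables (p : nat) (pp : prime p) (A B C : int).
Local Notation S := (padic_int p).
Local Notation F := (map_bq intr (BinaryQuartic A 0 B 0 C) : binary_quartic S).
Local Notation lin := (qlin (qbasis F 1) (qbasis F 2) (qbasis F 3)).
Let HQ : qpres p A B C (qbasis F 1) (qbasis F 2) (qbasis F 3) := qring_qpres pp A B C.

Let mem1 : 1 \in [:: 1; p%:Z]. Proof. by rewrite !inE eqxx. Qed.
Let memp : p%:Z \in [:: 1; p%:Z]. Proof. by rewrite !inE eqxx orbT. Qed.

(** The overring is the ring of F / p, with basis 1, z1 / p, z2 / p, z3 / p. *)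
Lemma not_maximal_content : (p %| A)%Z -> (p %| B)%Z -> (p %| C)%Z ->
  ~ maximal_quartic_ring (qring F).
Proof.
case/dvdzP=> a eA /dvdzP[b eB] /dvdzP[c eC].
apply: (not_maximal_qring (A := A) (B := B) (C := C) (p := p) pp (e20 := 0) (e21 := 0)
  (e30 := 0) (e31 := 0) (e32 := 0) mem1 mem1 mem1) => //; rewrite ?(qlinM HQ) ?eqxx ?orbT //.
- by apply: (int_spanI 0 p 0 0); rewrite /qlin; ring.
- by apply: (int_spanI 0 0 p 0); rewrite /qlin; ring.
- by apply: (int_spanI 0 0 0 p); rewrite /qlin; ring.
- by apply: (int_span_mulpI 0 0 a 0); rewrite /qlin eA; ring.
- by apply: (int_span_mulpI 0 (- b) 0 a); rewrite /qlin eA eB; ring.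
- by apply: (int_span_mulpI (- (a * c)) 0 0 0); rewrite /qlin eA eC; ring.
- by apply: (int_span_mulpI (- (a * c)) 0 (- b) 0); rewrite /qlin eA eB eC; ring.
- by apply: (int_span_mulpI 0 (- c) 0 0); rewrite /qlin eC; ring.
- by apply: (int_span_mulpI (- (b * c)) 0 (- c) 0); rewrite /qlin eB eC; ring.
Qed.

(** The overring adjoins z3 / p, whose square is -(C / p^2) (B + z2). *)
Lemma not_maximal_root0 : (p ^+ 2 %| C)%Z -> ~ maximal_quartic_ring (qring F).
Proof.
case/dvdzP=> c eC.
apply: (not_maximal_qring (A := A) (B := B) (C := C) (p := p) pp (e20 := 0) (e21 := 0)
  (e30 := 0) (e31 := 0) (e32 := 0) memp memp mem1) => //; rewrite ?(qlinM HQ) ?eqxx ?orbT //.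
- by apply: (int_spanI 0 1 0 0); rewrite /qlin; ring.
- by apply: (int_spanI 0 0 1 0); rewrite /qlin; ring.
- by apply: (int_spanI 0 0 0 p); rewrite /qlin; ring.
- by apply: (int_span_mulpI 0 0 A 0); rewrite /qlin; ring.
- by apply: (int_span_mulpI 0 (- B) 0 (A * p)); rewrite /qlin; ring.
- by apply: (int_span_mulpI (- (A * c * p)) 0 0 0); rewrite /qlin eC; ring.
- by apply: (int_span_mulpI (- (A * C)) 0 (- B) 0); rewrite /qlin; ring.
- by apply: (int_span_mulpI 0 (- (c * p)) 0 0); rewrite /qlin eC; ring.
- by apply: (int_span_mulpI (- (B * c)) 0 (- c) 0); rewrite /qlin eC; ring.
Qed.

(** The overring adjoins z1 / p, whose square is (A / p^2) z2. *)
Lemma not_maximal_root_oo : (p ^+ 2 %| A)%Z -> ~ maximal_quartic_ring (qring F).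
Proof.
case/dvdzP=> a eA.
apply: (not_maximal_qring (A := A) (B := B) (C := C) (p := p) pp (e20 := 0) (e21 := 0)
  (e30 := 0) (e31 := 0) (e32 := 0) mem1 memp memp) => //; rewrite ?(qlinM HQ) ?eqxx ?orbT //.
- by apply: (int_spanI 0 p 0 0); rewrite /qlin; ring.
- by apply: (int_spanI 0 0 1 0); rewrite /qlin; ring.
- by apply: (int_spanI 0 0 0 1); rewrite /qlin; ring.
- by apply: (int_span_mulpI 0 0 a 0); rewrite /qlin eA; ring.
- by apply: (int_span_mulpI 0 (- B) 0 (a * p)); rewrite /qlin eA; ring.
- by apply: (int_span_mulpI (- (a * C * p)) 0 0 0); rewrite /qlin eA; ring.
- by apply: (int_span_mulpI (- (A * C)) 0 (- B) 0); rewrite /qlin; ring.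
- by apply: (int_span_mulpI 0 (- (C * p)) 0 0); rewrite /qlin; ring.
- by apply: (int_span_mulpI (- (B * C)) 0 (- C) 0); rewrite /qlin; ring.
Qed.

(* Here F is congruent to A (x^2 - e y^2)^2 modulo p^2. *)
Lemma not_maximal_square (e b c : int) :
  B = b * p%:Z ^+ 2 - 2 * A * e -> C = A * e ^+ 2 + c * p%:Z ^+ 2 ->
  ~ maximal_quartic_ring (qring F).
Proof.
move=> eB eC.
(* For a root theta, [j2] is A (theta^2 - e) and [j3] is theta times it, up to b p^2 theta. *)
apply: (not_maximal_qring (A := A) (B := B) (C := C) (p := p) pp (e20 := - (A * e)) (e21 := 0)
  (e30 := 0) (e31 := e) (e32 := 0) memp mem1 mem1) => //; rewrite ?(qlinM HQ) ?eqxx ?orbT //.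
- by apply: (int_spanI 0 1 0 0); rewrite /qlin; ring.
- by apply: (int_spanI (A * e) 0 p 0); rewrite /qlin; ring.
- by apply: (int_spanI 0 (- e) 0 p); rewrite /qlin; ring.
- by apply: (int_span_mulpI (A ^+ 2 * e) 0 (A * p) 0); rewrite /qlin; ring.
- by apply: (int_span_mulpI 0 (- (b * p)) 0 A); rewrite /qlin eB; ring.
- by apply: (int_span_mulpI (- (A * c * p)) 0 (e * A) 0); rewrite /qlin eC; ring.
- by apply: (int_span_mulpI (- (A * c) - b * A * e) 0 (- (b * p)) 0); rewrite /qlin eB eC; ring.
- by apply: (int_span_mulpI 0 (- (c + e * b)) 0 0); rewrite /qlin eB eC; ring.
- by apply: (int_span_mulpI (- (b * C) - c * A * e) 0 (- (c * p)) 0); rewrite /qlin eB eC; ring.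
Qed.
End NotMaximal.

Section NotMaximalAt2.
Variables (A B C : int).
Local Notation F := (map_bq intr (BinaryQuartic A 0 B 0 C) : binary_quartic (padic_int 2)).
Local Notation lin := (qlin (qbasis F 1) (qbasis F 2) (qbasis F 3)).
Let HQ : qpres 2 A B C (qbasis F 1) (qbasis F 2) (qbasis F 3) :=
  qring_qpres (isT : prime 2) A B C.

(** The overring adjoins s / 2 for the [s] of [oi_shift], as s^2 = -(A + B + C) u - (4 A + 2 B) s
    with u = 3 A + B - 2 z1 + z2. *)
Lemma not_maximal_root1 : (4 %| A + B + C)%Z -> ~ maximal_quartic_ring (qring F).
Proof.
case/dvdzP=> m em; have eC : C = m * 4 - A - B by rewrite -em; ring.
apply: (not_maximal_qring (A := A) (B := B) (C := C) (p := 2) isT (d1 := 2) (d2 := 2)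
  (d3 := 1) (e20 := 0) (e21 := 0) (e30 := - (A + B)) (e31 := 1) (e32 := - 1)) => //;
  rewrite ?(qlinM HQ).
- by apply: (int_spanI (p := 2) 0 1 0 0); rewrite /qlin; ring.
- by apply: (int_spanI (p := 2) 0 0 1 0); rewrite /qlin; ring.
- by apply: (int_spanI (p := 2) (A + B) (- 1) 1 2); rewrite /qlin; ring.
- by apply: (int_span_mulpI (p := 2) 0 0 A 0); rewrite /qlin; ring.
- by apply: (int_span_mulpI (p := 2) (A * (A + B)) (- B - A) A (2 * A)); rewrite /qlin; ring.
- by apply: (int_span_mulpI (p := 2) (- (2 * A * m)) 0 0 (- A)); rewrite /qlin eC; ring.
- by apply: (int_span_mulpI (p := 2) (- (A * C)) 0 (- B) 0); rewrite /qlin; ring.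
- by apply: (int_span_mulpI (p := 2) (2 * A * m) (- (2 * m)) 0 A); rewrite /qlin eC; ring.
- apply: (int_span_mulpI (p := 2) (- (m * (3 * A + B))) (2 * m) (- m) (- (2 * A + B))).
  by rewrite /qlin eC; ring.
Qed.

(* Here F is congruent to A (x^4 + x^2 y^2 + y^4), hence to A (x^2 + x y + y^2)^2
   up to a multiple of 2 (x^2 + x y + y^2), modulo 4. *)
Lemma not_maximal_inert (b c : int) : B = A + b * 4 -> C = A + c * 4 ->
  ~ maximal_quartic_ring (qring F).
Proof.
move=> eB eC.
(* For a root theta, [j2] is A (theta^2 + theta + 1) and [j3] is theta times it, up to 4 b theta. *)
apply: (not_maximal_qring (A := A) (B := B) (C := C) (p := 2) isT (d1 := 2) (d2 := 1)
  (d3 := 1) (e20 := A) (e21 := 1) (e30 := 0) (e31 := 0) (e32 := 1)) => //;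
  rewrite ?(qlinM HQ).
- by apply: (int_spanI (p := 2) 0 1 0 0); rewrite /qlin; ring.
- by apply: (int_spanI (p := 2) (- A) (- 1) 2 0); rewrite /qlin; ring.
- by apply: (int_spanI (p := 2) A 1 (- 2) 2); rewrite /qlin; ring.
- by apply: (int_span_mulpI (p := 2) (- (A * A)) (- A) (2 * A) 0); rewrite /qlin; ring.
- by apply: (int_span_mulpI (p := 2) 0 (- (2 * b)) 0 A); rewrite /qlin eB; ring.
- by apply: (int_span_mulpI (p := 2) (- (2 * A * c)) (- (2 * b)) (- A) A); rewrite /qlin eB eC; ring.
- by apply: (int_span_mulpI (p := 2) (A * b - A * c) (- b) (- (2 * b)) A); rewrite /qlin eB eC; ring.
- apply: (int_span_mulpI (p := 2) (A * b - 2 * A * c) (- c) (- A - 2 * b) A).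
  by rewrite /qlin eB eC; ring.
- apply: (int_span_mulpI (p := 2) (A * (b + c) - 2 * A * c - b * C) (b - c) (- A - 2 * (b + c)) 0).
  by rewrite /qlin eB eC; ring.
Qed.
End NotMaximalAt2.

(** * Case analysis on the residues of A, B and C *)

Definition no_overring (p : nat) (A B C : int) : Prop :=
  forall (Q : comNzRingType) (z1 z2 z3 : Q) (I : Q -> Prop),
  overring_ideal p I -> qpres p A B C z1 z2 z3 ->
  forall n0 n1 n2 n3 : int, I (qlin z1 z2 z3 n0 n1 n2 n3) ->
  [/\ (p %| n0)%Z, (p %| n1)%Z, (p %| n2)%Z & (p %| n3)%Z].

(** [no_overring] ranges over all rings with the given table, so the basis of [qpres_rev] may be
    used. *)
Lemma no_overring_rev p A B C : no_overring p C B A -> no_overring p A B C.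
Proof.
move=> H Q z1 z2 z3 I HI /qpres_rev HQ n0 n1 n2 n3 Ia.
have [|p0] := H Q _ _ _ I HI HQ (n0 - B * n2) (- n3) (- n2) (- n1).
  by move: Ia; congr I; rewrite /qlin; ring.
rewrite !dvdzE !abszN -!dvdzE => p3 p2 p1; split=> //.
by rewrite -(subrK (B * n2) n0) rpredD ?dvdz_mull.
Qed.

Lemma no_overring_maximal p A B C : prime p -> no_overring p A B C ->
  maximal_at p (qring (BinaryQuartic A 0 B 0 C)).
Proof.
move=> pp H; apply/maximal_atE/maximal_qring => // I HI.
exact/(H _ _ _ _ _ HI)/qring_qpres.
Qed.

Lemma maximal_at_odd p A B C : prime p -> odd p ->
  maximal_at p (qring (BinaryQuartic A 0 B 0 C)) <->
  [/\ ~ [/\ (p %| A)%Z, (p %| B)%Z & (p %| C)%Z], ~~ (p%:Z ^+ 2 %| A)%Z,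
      ~~ (p%:Z ^+ 2 %| C)%Z & ~~ (p%:Z ^+ 2 %| B ^+ 2 - 4 * A * C)%Z].
Proof.
move=> pp p_odd; have p2 := p_odd2 pp p_odd.
have p4 : ~~ (p %| 4)%Z.
  by apply: contra p2; apply: (@Euclid_dvdzX p 2 2 pp).
have dvdpp m : (p%:Z ^+ 2 %| m)%Z -> (p %| m)%Z by apply: dvdz_trans; apply: dvdz_mulr.
have cop m n : ~~ (p %| m)%Z -> (p%:Z ^+ 2 %| m * n)%Z -> (p%:Z ^+ 2 %| n)%Z.
  by move=> pm; rewrite Gauss_dvdzr // coprimezXl // coprimez_prime.
split=> [/maximal_atE max|[ABC pA2 pC2 pD2]].
  have nABC : ~ [/\ (p %| A)%Z, (p %| B)%Z & (p %| C)%Z].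
    by move=> [pA pB pC]; apply: not_maximal_content max.
  have nA : ~~ (p%:Z ^+ 2 %| A)%Z by apply/negP => d; apply: not_maximal_root_oo max.
  have nC : ~~ (p%:Z ^+ 2 %| C)%Z by apply/negP => d; apply: not_maximal_root0 max.
  (* If p divides A, it divides B, so p^2 divides 4 A C: then p divides all of A, B, C or p^2
     divides A. *)
  split=> //; apply/negP => pD; case pA : (p %| A)%Z.
    have pB : (p %| B)%Z.
      apply: (Euclid_dvdzX (k := 2) pp); have := rpredD (dvdpp _ pD) (dvdz_mull (4 * C) pA).
      by congr (_ %| _)%Z; ring.
    case pC : (p %| C)%Z; first exact: nABC.
    case/negP: nA; apply: (cop (4 * C)).
      by rewrite Euclid_dvdzM // negb_or p4 pC.
    have := rpredB (dvdz_exp2r 2 pB) pD; congr (_ %| _)%Z; ring.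
  have pA2 : ~~ (p %| 2 * A)%Z by rewrite Euclid_dvdzM // negb_or p2 pA.
  (* Completing the square: with e = -B u, 4 A (C - A e^2) is 4 A C - B^2 modulo p^2. *)
  have [u [v uv]] : exists u v, (2 * A) * u = 1 + p%:Z ^+ 2 * v.
    by apply: coprimez_inv; rewrite coprimezXl // coprimez_prime.
  have eB : B = - (v * B) * p%:Z ^+ 2 - 2 * A * (- (B * u)).
    transitivity (B * ((2 * A) * u) - p%:Z ^+ 2 * v * B); last by ring.
    by rewrite uv; ring.
  have /dvdzP[c ec] : (p%:Z ^+ 2 %| C - A * (- (B * u)) ^+ 2)%Z.
    apply: (cop (4 * A)); first by rewrite Euclid_dvdzM // negb_or p4 pA.
    rewrite (_ : 4 * A * _ = 4 * A * C - (B * ((2 * A) * u)) ^+ 2); last by ring.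
    rewrite uv (_ : _ - _ = - (B ^+ 2 - 4 * A * C)
      - p%:Z ^+ 2 * (B ^+ 2 * (2 * v + p%:Z ^+ 2 * v ^+ 2))); last by ring.
    by apply: rpredB; [rewrite rpredN|exact: dvdz_mulr].
  apply: (not_maximal_square pp eB (c := c)) max.
  by rewrite -ec addrC subrK.
apply: no_overring_maximal => //.
have unram A' C' : (p %| B ^+ 2 - 4 * A' * C')%Z = false -> ~~ (p %| A')%Z ->
    ~~ (p%:Z ^+ 2 %| C')%Z -> no_overring p A' B C'.
  move=> pD pA pC Q z1 z2 z3 I HI HQ n0 n1 n2 n3.
  by apply: (maximal_odd_unramified pp HI HQ); rewrite ?pD.
have eis A' C' : (p %| B)%Z -> (p %| C')%Z -> ~~ (p %| A')%Z ->
    ~~ (p%:Z ^+ 2 %| C')%Z -> no_overring p A' B C'.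
  by move=> pB pC pA pC2' Q z1 z2 z3 I HI HQ n0 n1 n2 n3; apply: (maximal_eisenstein pp HI HQ).
have swapD : B ^+ 2 - 4 * C * A = B ^+ 2 - 4 * A * C by ring.
(* If p does not divide B^2 - 4 A C, then A or C is prime to p, or F is B x^2 y^2 modulo p. If it
   does, F modulo p is C y^4, A x^4, or A times the square of some x^2 - e y^2. *)
case pD : (p %| B ^+ 2 - 4 * A * C)%Z; last first.
  have [pA|pA] := boolP (p %| A)%Z; last exact: unram.
  have [pC|pC] := boolP (p %| C)%Z; last by apply/no_overring_rev/unram; rewrite ?swapD.
  move=> Q z1 z2 z3 I HI HQ n0 n1 n2 n3; apply: (maximal_mid pp HI HQ) => //.
  by apply/negP => pB; apply: ABC.
have pB_of : (p %| A)%Z || (p %| C)%Z -> (p %| B)%Z.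
  rewrite -Euclid_dvdzM // => pAC; apply: (Euclid_dvdzX (k := 2) pp).
  by have := rpredD pD (dvdz_mull 4 pAC); congr (_ %| _)%Z; ring.
have [pA|pA] := boolP (p %| A)%Z.
  apply/no_overring_rev/eis => //; first by rewrite pB_of ?pA.
  by apply/negP => pC; apply: ABC; rewrite pB_of ?pA.
have [pC|pC] := boolP (p %| C)%Z; first by apply: eis; rewrite ?pB_of ?pC ?orbT.
by move=> Q z1 z2 z3 I HI HQ n0 n1 n2 n3; apply: (maximal_odd_double pp HI HQ).
Qed.

(** A + B + C is odd when A, B, C are, so its condition modulo 4 can be imposed uniformly. *)
Lemma maximal_at_2 A B C :
  maximal_at 2 (qring (BinaryQuartic A 0 B 0 C)) <->
  [/\ oddz A || oddz B || oddz C, ~~ (4 %| A)%Z, ~~ (4 %| C)%Z, ~~ (4 %| A + B + C)%Z &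
      oddz A && oddz B && oddz C -> (4 %| A + B)%Z || (4 %| B + C)%Z].
Proof.
split=> [/maximal_atE max|[ABC pA2 pC2 pABC H]].
  split.
  - apply: contraT; rewrite !negb_or !negbK => /andP[/andP[pA pB] pC].
    by case: (not_maximal_content (p := 2) isT pA pB pC max).
  - by apply/negP => d; apply: (not_maximal_root_oo (p := 2) isT d max).
  - by apply/negP => d; apply: (not_maximal_root0 (p := 2) isT d max).
  - by apply/negP => d; apply: (not_maximal_root1 d max).
  (* For odd A, B, C, both divisibilities fail only when A, B, C are congruent modulo 4. *)
  - move=> oABC; apply: contraT => nABC.
    case: (@not_maximal_inert A B C ((B - A) %/ 4)%Z ((C - A) %/ 4)%Z _ _ max);
      by move: oABC nABC; rewrite /oddz; lia.
apply: no_overring_maximal => //.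
have c110 A' C' : oddz A' -> oddz B -> ~~ oddz C' ->
    ~~ (4 %| C')%Z -> ~~ (4 %| A' + B + C')%Z -> no_overring 2 A' B C'.
  move=> oA oB oC C4 ABC4 Q z1 z2 z3 I HI HQ n0 n1 n2 n3.
  exact: (maximal2_110 HI HQ).
have eis A' C' : oddz A' -> ~~ oddz B -> ~~ oddz C' -> ~~ (4 %| C')%Z ->
    no_overring 2 A' B C'.
  rewrite /oddz !negbK => oA oB oC C4 Q z1 z2 z3 I HI HQ n0 n1 n2 n3.
  exact: (@maximal_eisenstein 2 _ _ _ _ _ _ _ _ isT HI HQ).
have swapABC : C + B + A = A + B + C by ring.
case oA : (oddz A) ABC H; case oB : (oddz B); case oC : (oddz C) => //= _ H.
- move=> Q z1 z2 z3 I HI HQ n0 n1 n2 n3; apply: (maximal2_111 HI HQ) => //.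
  exact: H.
- by apply: c110; rewrite ?oC.
- by move=> Q z1 z2 z3 I HI HQ n0 n1 n2 n3; apply: (maximal2_101 HI HQ); rewrite ?oB.
- by apply: eis; rewrite ?oB ?oC.
- by apply/no_overring_rev/c110; rewrite ?oA ?swapABC.
- move=> Q z1 z2 z3 I HI HQ n0 n1 n2 n3.
  move: oA oC oB; rewrite /oddz => /negbFE oA /negbFE oC oB.
  exact: (@maximal_mid 2 _ _ _ _ _ _ _ _ isT HI HQ).
- by apply/no_overring_rev/eis; rewrite ?oA ?oB.
Qed.

Theorem theorem4p1 (A B C : int) :
  let F := BinaryQuartic A 0 B 0 C in
  (forall p : nat, prime p -> odd p ->
     maximal_at p (qring F) <->
       [/\ ~ [/\ (p %| A)%Z, (p %| B)%Z & (p %| C)%Z],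
           (A != 0 %[mod p%:Z ^+ 2])%Z,
           (C != 0 %[mod p%:Z ^+ 2])%Z &
           (B ^+ 2 - 4 * A * C != 0 %[mod p%:Z ^+ 2])%Z]) /\
  (maximal_at 2 (qring F) <->
     [/\ ~ [/\ (2 %| A)%Z, (2 %| B)%Z & (2 %| C)%Z],
         (A != 0 %[mod 4])%Z,
         (C != 0 %[mod 4])%Z,
         [\/ (2 %| A)%Z, (2 %| B)%Z | (2 %| C)%Z] ->
           (A + B + C != 0 %[mod 4])%Z &
         [/\ ~~ (2 %| A)%Z, ~~ (2 %| B)%Z & ~~ (2 %| C)%Z] ->
           (A + B == 0 %[mod 4])%Z \/ (B + C == 0 %[mod 4])%Z]).
Proof.
move=> F; rewrite !eqz_mod_dvd !subr0.
split=> [p pp p_odd|].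
  by rewrite !eqz_mod_dvd !subr0; apply: maximal_at_odd.
apply: (iff_trans (maximal_at_2 A B C)).
have even n : (2 %| n)%Z = ~~ oddz n by rewrite negbK.
rewrite (even A) (even B) (even C).
split=> -[ABC pA pC pABC H]; split=> //.
- by move=> [oA oB oC]; move: ABC; rewrite (negPf oA) (negPf oB) (negPf oC).
- by case; rewrite !negbK => oA oB oC; apply/orP/H; rewrite oA oB oC.
- by apply: contraT; rewrite !negb_or => /andP[/andP[oA oB] oC]; case: ABC.
- have [oA|oA] := boolP (oddz A); last by apply: pABC; apply: Or31.
  have [oB|oB] := boolP (oddz B); last by apply: pABC; apply: Or32.
  have [oC|oC] := boolP (oddz C); last by apply: pABC; apply: Or33.
  by move: oA oB oC; rewrite /oddz; lia.
- by move=> /andP[/andP[oA oB] oC]; apply/orP/H; rewrite !negbK.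
Qed.
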